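(* Let $l\ge1$, $\mathbf v=(v_1,\dots,v_l)\in\mathbb Z^l$ with $v_1\ge\dots\ge v_l$, and let $S$ be an ordered symbol of multicharge $\mathbf v$. Then the canonical basis element $G(S)$ is given by $$G(S)=\sum_{\sigma\in\mathfrak S(S)}q^{N(\sigma,S)}S^\sigma,\qquad N(\sigma,S)=\ell(\sigma)-M(S^\sigma),$$ where $\mathfrak S(S)$ is the set of column permutations admissible for $S$. In addition, $G(S)$ is monomial.
   Context: Symbols. For $s\in\mathbb Z$, $\mathfrak B_s$ is the set of strictly increasing integer sequences $\beta=(\beta_j)_{j\le s}$ with $\beta_j=j$ for all sufficiently negative $j$; such a sequence is also viewed as the set of its values. A symbol of multicharge $\mathbf v$ is a tuple $S=(\beta^1,\dots,\beta^l)$ with $\beta^i=(\beta^i_j)_{j\le v_i}\in\mathfrak B_{v_i}$; $\beta^i$ is the $i$-th row (row 1 on top). Its size is $\sum_i\sum_{j\le v_i}(\beta^i_j-j)$. $\mathcal S_{\mathbf v}$ is the set of symbols of multicharge $\mathbf v$ and $\emptyset_{\mathbf v}$ the symbol of size $0$. $S$ is standard if $\beta^i_j\le\beta^{i+1}_j$ for all $1\le i<l$ and $j\le v_{i+1}$. $S$ is ordered if it is standard and $\beta^1_i\ge\beta^c_{i-1}$ for all $i\le v_1$ and all $c\in\{1,\dots,l\}$ for which $\beta^c_{i-1}$ exists. Column permutations. The $j$-th column ($j\le v_1$) is $X_j=(\beta^1_j,\dots,\beta^{h_j}_j)$, of height $h_j$, where $h_j=r$ iff $v_{r+1}<j\le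 v_r$ (with $v_{l+1}=-\infty$). Let $\mathfrak S_{\mathbf v}=\prod_{j\le v_1}\mathfrak S_{h_j}$, where $\mathfrak S_r$ is the symmetric group with Coxeter generators the transpositions $(k,k+1)$ and corresponding length function $\ell$. For $\sigma=(\sigma_j)_j\in\mathfrak S_{\mathbf v}$, $\ell(\sigma)=\sum_j\ell(\sigma_j)\in\mathbb N\cup\{\infty\}$. Let $S^\sigma$ be the array whose $j$-th column is $(\beta_j^{\sigma_j(1)},\dots,\beta_j^{\sigma_j(h_j)})$. $\sigma$ is admissible for $S$ if (i) $S^\sigma$ is a well-defined symbol, i.e. has no repetition in any row, and (ii) $\sigma$ has minimal length among all $w\in\mathfrak S_{\mathbf v}$ with $S^w=S^\sigma$. Admissible elements have finite length. For a symbol $T=(\beta^1,\dots,\beta^l)$ of multicharge $\mathbf v$, $$M(T)=\sum_{j\le v_1}\sum_{t=1}^{h_j}\#\{k\in\{1,\dots,t-1\} : \beta^k_{j-1}=\beta^t_j\}$$ (only finitely many terms are nonzero). Fock space. $\mathcal F_{\mathbf v}$ is the $\mathbb Q(q)$-vector space with basis $\mathcal S_{\mathbf v}$. It is a $U_q(\mathfrak{gl}_\infty)$-module (the tensor product of the level-one modules $V(\Lambda_{v_1})\otimes\dots\otimes V(\Lambda_{v_l})$), in which, for $i\in\mathbb Z$, $$F_i\cdot S=\sum_{S'}q^{\#\{k>j\,:\,i\in\beta^k\}-\#\{k>j\,:\,i+1\in\beta^k\}}S',$$ the sum being over all symbols $S'$ obtained from $S=(\beta^1,\dots,\beta^l)$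 by replacing, in a single row $j$, an entry $i$ by $i+1$ (this requires $i\in\beta^j$, $i+1\notin\beta^j$). For $a\ge 0$, $F_i^{(a)}=F_i^a/[a]!$ with $[r]=(q^r-q^{-r})/(q-q^{-1})$ and $[a]!=[a][a-1]\cdots[1]$. Canonical basis. $V_{\mathbf v}\subset\mathcal F_{\mathbf v}$ is the $U_q(\mathfrak{gl}_\infty)$-submodule generated by $\emptyset_{\mathbf v}$, i.e. the $\mathbb Q(q)$-span of all $F_{i_1}\cdots F_{i_m}\cdot\emptyset_{\mathbf v}$. The bar involution $u\mapsto\overline u$ of $V_{\mathbf v}$ is the unique $\mathbb Q$-linear map with $\overline{f(q)u}=f(q^{-1})\overline u$ for $f(q)\in\mathbb Q(q)$, $\overline{F_i u}=F_i\overline u$ and $\overline{\emptyset_{\mathbf v}}=\emptyset_{\mathbf v}$. Let $V_{\mathbf v}^{\mathbb Z}$ be the $\mathbb Z[q,q^{-1}]$-span of all $F_{i_1}^{(a_1)}\cdots F_{i_m}^{(a_m)}\cdot\emptyset_{\mathbf v}$, let $R\subset\mathbb Q(q)$ be the ring of rational functions regular at $q=0$, and $\mathcal F_{\mathbf v,R}$ the $R$-span of the symbols. For each standard symbol $S\in\mathcal S_{\mathbf v}$, $G(S)$ is the unique element of $V_{\mathbf v}^{\mathbb Z}$ with $\overline{G(S)}=G(S)$ and $G(S)\equiv S \bmod q\mathcal F_{\mathbf v,R}$ (existence and uniqueness are known); the $G(S)$ form the canonical basis of $V_{\mathbf v}$. $G(S)$ is monomial if $G(S)=F_{i_1}^{(a_1)}\cdots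 F_{i_r}^{(a_r)}\cdot\emptyset_{\mathbf v}$ for some integers $i_1,\dots,i_r$ with $i_j\ne i_{j+1}$ and some $a_1,\dots,a_r\in\mathbb N$. *)

(* Defs.v *)
From mathcomp Require Import all_boot all_order all_algebra fingroup perm.
From mathcomp Require Import boolp classical_sets functions cardinality fsbigop.
From mathcomp Require Import finmap monalg.

Set Implicit Arguments.
Unset Strict Implicit.
Unset Printing Implicit Defensive.

Import Order.TTheory GRing.Theory Num.Theory.
Local Open Scope ring_scope.

(* Rows are numbered from 0: the row called row 1 in the mathematics is the
   row of value 0 in 'I_l, and a multicharge is a function v : 'I_l -> int. *)

Section Symbols.

Variable l : nat.

(* An array A has entries A t j, for a row t and a column j.  Entry (t, j)
   exists only for j <= v t; symbols carry the dummy value 0 elsewhere, so that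
   equality of arrays is equality of symbols. *)
Definition array : Type := 'I_l -> int -> int.

Variable v : 'I_l -> int.

Definition multicharge : Prop := forall s t : 'I_l, (s <= t)%N -> v t <= v s.

Definition is_symbol (A : array) : Prop := forall t : 'I_l,
  [/\ forall j k : int, j < k -> k <= v t -> A t j < A t k,
      exists N : int, forall j : int, j <= N -> A t j = j
    & forall j : int, v t < j -> A t j = 0].

Definition symbol : Type := {A : array | `[< is_symbol A >]}.

Definition empty_array : array := fun t j => if j <= v t then j else 0.

Lemma empty_arrayP : is_symbol empty_array.
Proof.
move=> t; split=> [j k ltjk lekv||j ltvj]; rewrite /empty_array.
- by rewrite lekv (le_trans (ltW ltjk) lekv).
- by exists (v t) => j ->.
- by rewrite leNgt ltvj.
Qed.

Definition empty_symbol : symbol := exist _ empty_array (asboolT empty_arrayP).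

Definition standard (S : symbol) : Prop :=
  forall (s t : 'I_l) (j : int), t = s.+1 :> nat -> j <= v t ->
    val S s j <= val S t j.

Definition ordered (S : symbol) : Prop :=
  standard S /\
  forall (r c : 'I_l) (j : int), r = 0%N :> nat -> j <= v r -> j - 1 <= v c ->
    val S c (j - 1) <= val S r j.

(* i \in beta^t, the row being seen as the set of its values *)
Definition has_entry (A : array) (t : 'I_l) (i : int) : bool :=
  `[< exists2 j : int, j <= v t & A t j = i >].

(* Column permutations.  The multicharge being nonincreasing, column j of
   height h consists of the first h rows, which are the rows t with j <= v t.
   A family in prod_j S_{h_j} is represented by permutations of all rows,
   sigma j being supported on column j (hence trivial for j > v_1). *)

Definition column (j : int) : {set 'I_l} := [set t : 'I_l | j <= v t]%SET.

Definition col_perm (sigma : int -> 'S_l) : Prop :=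
  forall j : int, perm_on (column j) (sigma j).

Definition simple_transposition (j : int) (s : 'S_l) : bool :=
  [exists k in column j, exists m in column j,
     (m == k.+1 :> nat) && (s == tperm k m)].

Definition least (P : nat -> Prop) : nat :=
  xget 0%N [set n | P n /\ forall m, P m -> (n <= m)%N]%classic.

Definition col_length (j : int) (s : 'S_l) : nat :=
  least (fun n => exists w : seq 'S_l,
    [/\ size w = n, all (simple_transposition j) w
      & s = (\prod_(x <- w) x)%g]).

(* None stands for infinite length *)
Definition perm_length (sigma : int -> 'S_l) : option nat :=
  if `[< finite_set [set j : int | sigma j <> 1%g]%classic >]
  then Some (\big[addn/0%N]_(j \in [set: int]%classic) col_length j (sigma j))
  else None.

Definition length_le (m n : option nat) : bool :=
  match m, n with
  | _, None => true
  | None, Some _ => false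
  | Some a, Some b => (a <= b)%N
  end.

Definition permute (A : array) (sigma : int -> 'S_l) : array :=
  fun t j => A (sigma j t) j.

(* Condition (i), that S^sigma be a well-defined symbol, is is_symbol; when S is
   ordered every entry of column j - 1 is at most every entry of column j, and
   then this says exactly that no row of S^sigma has a repetition. *)
Definition admissible (S : symbol) (sigma : int -> 'S_l) : Prop :=
  [/\ col_perm sigma,
      is_symbol (permute (val S) sigma)
    & forall w : int -> 'S_l, col_perm w ->
        permute (val S) w = permute (val S) sigma ->
        length_le (perm_length sigma) (perm_length w)].

(* Only finitely many columns contribute when T is a symbol. *)
Definition Mstat (T : array) : nat :=
  \big[addn/0%N]_(j \in [set: int]%classic)
    (\big[addn/0%N]_(t in column j)
       #|[set k : 'I_l | (k < t)%N & T k (j - 1) == T t j]%SET|).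

Definition Nstat (sigma : int -> 'S_l) (S : symbol) : int :=
  (odflt 0%N (perm_length sigma))%:Z - (Mstat (permute (val S) sigma))%:Z.

End Symbols.

Notation Qq := {fraction {poly rat}}.

Definition q : Qq := tofrac 'X.

Definition subst_q (x : Qq) (p : {poly rat}) : Qq := (map_poly ratr p).[x].

(* f(q) |-> f(q^-1); independent of the representative chosen by repr *)
Definition bar_scalar (f : Qq) : Qq :=
  subst_q q^-1 (frac (generic_quotient.repr f)).1 / subst_q q^-1 (frac (generic_quotient.repr f)).2.

Definition laurent_int (f : Qq) : Prop :=
  exists (p : {poly int}) (n : nat), f = (map_poly intr p).[q] / q ^+ n.

Definition regular0 (f : Qq) : Prop :=
  exists a b : {poly rat}, b.[0] != 0 /\ f = tofrac a / tofrac b.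

Definition qint (r : nat) : Qq := (q ^+ r - q ^- r) / (q - q^-1).
Definition qfact (a : nat) : Qq := \prod_(1 <= r < a.+1) qint r.

Section Fock.

Variables (l : nat) (v : 'I_l -> int).

Definition fock := {malg Qq[symbol v]}.

(* The basis vector of an array which is a symbol. *)
Definition basis_vec (A : array l) : fock :=
  if insub A is Some T then << T >> else 0.

Definition vacuum : fock := << empty_symbol v >>.

(* Replaces the entry i by i + 1 in row t. *)
Definition raise_entry (A : array l) (t : 'I_l) (i : int) : array l :=
  fun s j => if [&& s == t, j <= v s & A s j == i] then i + 1 else A s j.

Definition count_below (S : symbol v) (t : 'I_l) (i : int) : nat :=
  #|[set k : 'I_l | (t < k)%N & has_entry v (val S) k i]%SET|.

Definition F_symbol (i : int) (S : symbol v) : fock :=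
  \sum_(t < l | has_entry v (val S) t i && ~~ has_entry v (val S) t (i + 1))
    q ^ ((count_below S t i)%:Z - (count_below S t (i + 1))%:Z)
      *: basis_vec (raise_entry (val S) t i).

Definition F (i : int) (u : fock) : fock :=
  \sum_(S <- msupp u) u@_S *: F_symbol i S.

Definition Fdiv (i : int) (a : nat) (u : fock) : fock :=
  (qfact a)^-1 *: iter a (F i) u.

Definition F_word (w : seq int) : fock := foldr F vacuum w.

Definition Fdiv_word (w : seq (int * nat)) : fock :=
  foldr (fun ia u => Fdiv ia.1 ia.2 u) vacuum w.

Inductive span (C : Qq -> Prop) (X : fock -> Prop) : fock -> Prop :=
| span_nil : span C X 0
| span_cons c x u : C c -> X x -> span C X u -> span C X (c *: x + u).

Definition V : fock -> Prop :=
  span (fun=> True) (fun x => exists w, x = F_word w).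

Definition VZ : fock -> Prop :=
  span laurent_int (fun x => exists w, x = Fdiv_word w).

Definition fock_regular0 : fock -> Prop :=
  span regular0 (fun x => exists S : symbol v, x = << S >>).

(* Only the values of bar on V matter. *)
Record is_bar_involution (bar : fock -> fock) : Prop := IsBarInvolution {
  bar_stable : forall u, V u -> V (bar u);
  bar_add : forall u w, V u -> V w -> bar (u + w) = bar u + bar w;
  bar_scale : forall f u, V u -> bar (f *: u) = bar_scalar f *: bar u;
  bar_F : forall i u, V u -> bar (F i u) = F i (bar u);
  bar_vacuum : bar vacuum = vacuum
}.

Definition canonical_spec (bar : fock -> fock) (S : symbol v) (g : fock) :
    Prop :=
  [/\ VZ g, bar g = g
    & exists2 u, fock_regular0 u & g - << S >> = q *: u].

(* g is G(S) *)
Definition is_canonical_element (bar : fock -> fock) (S : symbol v) (g : fock) :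
    Prop :=
  unique (canonical_spec bar S) g.

Definition monomial (g : fock) : Prop :=
  exists2 w : seq (int * nat),
    sorted (fun x y => x.1 != y.1) w & g = Fdiv_word w.

End Fock.

(* Main.v *)
(* The exponent N(sigma, S) depends only on the symbol U = S^sigma: since the columns
   of S are nondecreasing, an element of minimal length of its class has one inversion
   for each inversion of U, so N = inv(U) - M(U), and admissible permutations
   correspond to the symbols U with the same column contents as S.

   An ordered symbol is built from the empty one column by column, from the right to
   the left, each column being raised by divided powers F_i^(a) acting on its maximal
   entries until it reaches its final position.  If T is obtained from S by lowering
   to i the maximal entries i + 1 of the leftmost nontrivial column, the coefficients of
   F_i^(a) on the rearrangements of T are q to the differences of inv - M, whence
   G(S) = F_i^(a) G(T).  So the sum is monomial, hence bar invariant and integral.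

   Finally M(U) <= inv(U): if k < t and the entry (k, j - 1) of U equals the entry
   (t, j), then (k, t) is an inversion of column j.  In the equality case inversions
   would propagate to all the columns on the left, so U = S, and the sum is congruent
   to S modulo q. *)
Require Import Defs.
From mathcomp Require Import all_boot all_order all_algebra fingroup perm.
From mathcomp Require Import boolp classical_sets functions cardinality fsbigop.
From mathcomp Require Import finmap monalg.
From mathcomp Require Import zify ring.

Set Implicit Arguments.
Unset Strict Implicit.
Unset Printing Implicit Defensive.

Import Order.TTheory GRing.Theory Num.Theory.
Local Open Scope ring_scope.

(** * Inversions and stable sorting of columns *)

Section Permutations.

Variable l : nat.
Implicit Types (s : 'S_l) (D : {set 'I_l}) (a b t : 'I_l).

(** Columns have this property because the multicharge is nonincreasing; nothing else about their
    shape is used for sorting. *)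
Definition down_closed D : Prop :=
  forall a b, (a <= b)%N -> b \in D -> a \in D.

Lemma card_ord_ltn (n : nat) : (n <= l)%N -> #|[set a : 'I_l | (a < n)%N]%SET| = n.
Proof.
move=> lenl; rewrite -sum1dep_card -(big_ord_widen l (fun=> 1%N)) //.
by rewrite sum1_card card_ord.
Qed.

Lemma mem_down_closed D t : down_closed D -> (t \in D) = (t < #|D|)%N.
Proof.
move=> downD; apply/idP/idP => [tD|].
  rewrite -(card_ord_ltn (ltn_ord t)); apply/subset_leq_card/fintype.subsetP => a.
  by rewrite inE ltnS => leat; apply: downD tD.
apply: contraLR => tD; rewrite -leqNgt -[leqRHS](card_ord_ltn (ltnW (ltn_ord t))).
apply/subset_leq_card/fintype.subsetP => a aD; rewrite inE ltnNge.
by apply: contra tD => leta; apply: downD aD.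
Qed.

Lemma perm_val_card s t : (s t : nat) = #|[set b | (s b < s t)%N]%SET|.
Proof.
rewrite -(card_imset _ (@perm_inj _ s)) -[LHS](card_ord_ltn (ltnW (ltn_ord (s t)))).
congr #|pred_of_set _|; apply/setP => a; rewrite inE; apply/idP/imsetP => [lta|].
  by exists (s^-1 a)%g; rewrite ?inE permKV.
by case=> b; rewrite inE => ltb ->.
Qed.

Definition inversions s : {set 'I_l * 'I_l} :=
  [set p : 'I_l * 'I_l | (p.1 < p.2)%N && (s p.2 < s p.1)%N]%SET.

(** The value [s t] is the number of rows [b] with [s b < s t], and for each [b] the inversion set
    decides whether this inequality holds. *)
Lemma inversions_inj : injective inversions.
Proof.
move=> s s' eqss'; apply/permP => t; apply: val_inj.
rewrite /= (perm_val_card s) (perm_val_card s').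
congr #|pred_of_set _|; apply/setP => b; rewrite !inE.
have [ltbt|lttb|/val_inj ->] := ltngtP b t; last by rewrite !ltnn.
- have /setP/(_ (b, t)) := eqss'; rewrite !inE ltbt /= => eqbt.
  have neq (x : 'S_l) : x b != x t :> nat.
    by apply: contraTneq ltbt => /val_inj/perm_inj ->; rewrite ltnn.
  by have := neq s; have := neq s'; lia.
- by have /setP/(_ (t, b)) := eqss'; rewrite !inE lttb.
Qed.

Lemma inversions1 : inversions 1 = finset.set0.
Proof. by apply/setP => p; rewrite !inE !perm1; lia. Qed.

Section Adjacent.

Variables (k m : 'I_l) (mk : m = k.+1 :> nat).

Let tau := tperm k m.

(** As [k] and [m] are adjacent, [tau] preserves the order of every pair of rows except (k, m), so
    it permutes the other increasing pairs. *)
Lemma inversions_tperm s (P : pred ('I_l * 'I_l)) :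
  #|[set p : 'I_l * 'I_l | (p.1 < p.2)%N && P (tau p.1, tau p.2) & p != (k, m)]%SET| =
  #|[set p : 'I_l * 'I_l | (p.1 < p.2)%N && P p & p != (k, m)]%SET|.
Proof.
pose h p := (tau p.1, tau p.2).
have hK : involutive h by case=> a b; rewrite /h /= !tpermK.
rewrite -(card_imset _ (inv_inj hK)); congr #|pred_of_set _|; apply/setP => -[a b].
have tauE x : tau x =
    (if x == k :> nat then k.+1 else if x == k.+1 :> nat then k : nat else x) :> nat.
  rewrite /tau; case: tpermP => [->|->|/eqP + /eqP]; rewrite ?mk ?eqxx //.
    by rewrite eqn_leq ltnn.
  by rewrite -!val_eqE /= mk => /negPf-> /negPf->.
have key (x y : 'I_l) : (x < y)%N && ((x, y) != (k, m)) ->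
    (tau x < tau y)%N && ((tau x, tau y) != (k, m)).
  rewrite !xpair_eqE -!val_eqE /= !tauE mk.
  by do 4![case: eqP => /= ?]; lia.
apply/imsetP/idP => [[[x y]]|].
  rewrite !inE /= => /andP[/andP[ltxy Pxy] nxy] [-> ->].
  by have := key x y; rewrite ltxy nxy => /(_ isT)/andP[-> ->]; rewrite Pxy.
rewrite !inE /= => /andP[/andP[ltxy Pxy] nxy].
exists (h (a, b)); last by rewrite hK.
rewrite !inE /=; have := key a b; rewrite ltxy nxy => /(_ isT)/andP[-> ->].
by rewrite /h /tau /= !tpermK Pxy.
Qed.

(** Only the pair (k, m) can become or cease to be an inversion; the two booleans record which
    happens, without subtraction. *)
Lemma card_inversions_tperm s :
  (#|inversions (tau * s)%g| + (s m < s k) = #|inversions s| + (s k < s m))%N.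
Proof.
have ltkm : (k < m)%N by rewrite mk.
rewrite (cardsD1 (k, m)) [X in (_ = X + _)%N](cardsD1 (k, m)).
rewrite !inE /= ltkm !permM /tau tpermL tpermR /=.
set A := #|_|; set B := #|_|; suff -> : A = B by lia.
have := inversions_tperm s (fun p => (s p.2 < s p.1)%N).
congr (_ = _); apply: eq_card => p; rewrite !inE andbC //; congr andb.
by rewrite /= !permM.
Qed.

Lemma card_inversions_tperm_le s :
  (#|inversions (tau * s)%g| <= #|inversions s|.+1)%N.
Proof. by have := card_inversions_tperm s; case: (s m < s k)%N; case: (s k < s m)%N; lia. Qed.

End Adjacent.

(** Without a descent between adjacent rows of [D], [s] increases on [D]; being the identity
    elsewhere, it then has no inversion at all. *)
Lemma exists_descent D s : down_closed D -> perm_on D s -> s != 1%g ->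
  exists k m : 'I_l, [/\ m = k.+1 :> nat, k \in D, m \in D & (s m < s k)%N].
Proof.
move=> downD sD; apply: contraNP => nodesc.
have homo n : forall a b, (a + n.+1)%N = b -> b \in D -> (s a < s b)%N.
  elim: n => [|n IHn] a b eqb bD.
    rewrite ltnNge leq_eqVlt negb_or; apply/andP; split.
      by apply: contraTneq (leqnn a) => /val_inj/perm_inj eab; move: eqb; rewrite eab; lia.
    apply/negP => lts; apply: nodesc; exists a, b; split=> //; first lia.
    by apply: downD bD; lia.
  have ltb : (b.-1 < l)%N by have := ltn_ord b; lia.
  apply: (@ltn_trans (s (Ordinal ltb))).
    by apply: IHn => /=; [lia|apply: downD bD => /=; lia].
  rewrite ltnNge leq_eqVlt negb_or; apply/andP; split.
    by apply/negP => /eqP/val_inj/perm_inj/(congr1 val) /=; lia.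
  apply/negP => lts; apply: nodesc; exists (Ordinal ltb), b; split=> //=; first lia.
  by apply: downD bD => /=; lia.
apply/eqP/inversions_inj; rewrite inversions1; apply/setP => -[a b].
rewrite !inE; apply/negP => /= /andP[ltab].
have [bD|bD] := boolP (b \in D).
  by apply/negP; rewrite -leqNgt ltnW // (homo (b - a).-1) //; lia.
rewrite (out_perm sD bD); have [aD|aD] := boolP (a \in D).
  rewrite -(perm_closed _ sD) in aD => ltbs.
  by case/negP: bD; apply: downD aD; apply: ltnW.
by rewrite (out_perm sD aD); lia.
Qed.

(* Among the s with f = g \o s, for a nondecreasing g, these are the ones of
   minimal length: f b < f a already forces s b < s a. *)
Definition stable_sort_of D (f : 'I_l -> int) s : Prop :=
  perm_on D s /\
  inversions s = [set p : 'I_l * 'I_l | [&& (p.1 < p.2)%N, p.2 \in D & f p.2 < f p.1]]%SET.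

Lemma stable_sort_unique D f s s' :
  stable_sort_of D f s -> stable_sort_of D f s' -> s = s'.
Proof. by move=> [_ e] [_ e']; apply: inversions_inj; rewrite e. Qed.

(** Both cardinals split into fibres over one finite list that contains the values of [f] and of
    [g]. *)
Lemma card_eq_count D (f g : 'I_l -> int) :
  (forall x, #|[set t in D | f t == x]%SET| = #|[set t in D | g t == x]%SET|) ->
  forall P : pred int,
    #|[set t in D | P (f t)]%SET| = #|[set t in D | P (g t)]%SET|.
Proof.
move=> cnt P; pose r := undup ([seq f t | t : 'I_l] ++ [seq g t | t : 'I_l]).
have key (h : 'I_l -> int) : (forall t, h t \in r) ->
    #|[set t in D | P (h t)]%SET| = (\sum_(x <- r | P x) #|[set t in D | h t == x]%SET|)%N.
  move=> hr.
  under eq_bigr => x _ do rewrite -sum1dep_card big_mkcondr /=.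
  rewrite exchange_big -sum1dep_card big_mkcondr /=; apply: eq_bigr => t _.
  rewrite big_mkcond (bigD1_seq (h t)) ?undup_uniq //= eqxx big1 ?addn0 // => x.
  by rewrite eq_sym => /negPf ->; rewrite if_same.
rewrite !key => [|t|t]; first by apply: eq_bigr => x _; rewrite cnt.
  by rewrite mem_undup mem_cat orbC map_f ?mem_enum.
by rewrite mem_undup mem_cat map_f ?mem_enum.
Qed.

Section StableSort.

Variables (D : {set 'I_l}) (f : 'I_l -> int).
Hypothesis downD : down_closed D.

(** The order that defines stable sorting: by value, ties being broken by the row number. *)
Let before a b := (f a < f b) || (f a == f b) && (a < b)%N.

Let before_trans a b c : before a b -> before b c -> before a c.
Proof.
rewrite /before => /orP[lt1|/andP[/eqP e1 lt1]] /orP[lt2|/andP[/eqP e2 lt2]].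
- by rewrite (lt_trans lt1 lt2).
- by rewrite -e2 lt1.
- by rewrite e1 lt2.
- by rewrite e1 e2 eqxx (ltn_trans lt1 lt2) orbT.
Qed.

Let before_total a b : a != b -> before a b || before b a.
Proof.
by rewrite /before -val_eqE neq_ltn; case: ltgtP => //= _ /orP[] ->; rewrite ?orbT.
Qed.

(** A row of [D] is sent to its rank for [before]. For a < b, row b precedes row a exactly when f b
    < f a, which gives the inversions. The rank formula is kept in the conclusion for later use. *)
Lemma exists_stable_sort : exists s, stable_sort_of D f s /\
  {in D, forall t,
    (s t : nat) = #|[set a in D | (f a < f t) || (f a == f t) && (a < t)%N]%SET|}.
Proof.
pose rk t := #|[set a in D | before a t]%SET|.
have rk_ltD t : t \in D -> (rk t < #|D|)%N.
  move=> tD; apply/proper_card/fintype.properP; split.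
    by apply/fintype.subsetP => a; rewrite inE => /andP[].
  by exists t => //; rewrite inE /before ltxx ltnn andbF andbF.
have rk_lt t : t \in D -> (rk t < l)%N.
  by move=> /rk_ltD /leq_trans; apply; rewrite -[X in (_ <= X)%N]card_ord max_card.
(* The default [t] of [insubd] is never taken, since ranks are less than [l]. *)
pose r t := if t \in D then insubd t (rk t) else t.
have rE t : t \in D -> r t = rk t :> nat.
  by move=> tD; rewrite /r tD val_insubd rk_lt.
have r_before a b : a \in D -> b \in D -> before a b -> (r a < r b)%N.
  move=> aD bD ab; rewrite !rE //; apply/proper_card/fintype.properP; split.
    by apply/fintype.subsetP => c; rewrite !inE => /andP[-> /= ca]; apply: before_trans ab.
  by exists a; rewrite !inE aD //= /before ltxx ltnn andbF.
have rD t : (r t \in D) = (t \in D).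
  have [tD|tD] := boolP (t \in D); last by rewrite /r (negPf tD) (negPf tD).
  by rewrite mem_down_closed // rE // rk_ltD.
have r_inj : injective r.
  move=> a b eqr; apply/eqP; apply/idPn => neqab.
  have := rD a; rewrite eqr rD; have [aD bD|aD bD] := boolP (a \in D).
    by have /orP[/(r_before _ _ aD bD)|/(r_before _ _ bD aD)] := before_total neqab;
      rewrite eqr ltnn.
  by move: eqr neqab; rewrite /r (negPf aD) bD => ->; rewrite eqxx.
exists (perm r_inj); split; last by move=> t tD; rewrite permE rE.
split.
  apply/fintype.subsetP => t; rewrite !inE permE /r.
  by case: ifP => // _; rewrite eqxx.
apply/setP => -[a b]; rewrite !inE !permE /=; have [ltab|//] := ltnP a b.
have [bD|bD] /= := boolP (b \in D).
  have aD : a \in D by apply: downD bD; apply: ltnW.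
  apply/idP/idP => [|lt]; last by apply: r_before => //; rewrite /before lt.
  apply: contraLR; rewrite -leNgt -leqNgt => le.
  by rewrite ltnW // r_before // /before ltab andbT orbC -le_eqVlt.
apply/negP; rewrite /r (negPf bD); case: ifP => [aD|_]; last by lia.
rewrite -/(r a) => ltb; case/negP: bD.
have : r a \in D by rewrite rD.
by rewrite {1}/r aD; apply: downD; apply: ltnW.
Qed.

Variable g : 'I_l -> int.
Hypothesis g_mono : forall a b, (a <= b)%N -> b \in D -> g a <= g b.

(** The lower bound on the inversions of any [s] that sorts [f] into [g]; stable sorts attain it. *)
Lemma stable_sort_card_le s : perm_on D s -> {in D, forall t, f t = g (s t)} ->
  [set p : 'I_l * 'I_l | [&& (p.1 < p.2)%N, p.2 \in D & f p.2 < f p.1]]%SET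
    \subset inversions s.
Proof.
move=> sD fg; apply/fintype.subsetP => -[a b]; rewrite !inE /= => /and3P[ltab bD].
have aD : a \in D by apply: downD bD; apply: ltnW.
rewrite !fg // ltab /= ltnNge; apply: contraL => lts.
by rewrite -leNgt g_mono // perm_closed.
Qed.

(** As [g] is nondecreasing, the rows of [D] where g < x form an initial segment, whose size also
    counts the rows where f < x; likewise with <=. Since [s t] is the rank of [t] for [f], comparing
    it with these sizes at x = f t pins down [g (s t)]. *)
Lemma stable_sortE s :
  (forall x, #|[set t in D | f t == x]%SET| = #|[set t in D | g t == x]%SET|) ->
  stable_sort_of D f s -> {in D, forall t, f t = g (s t)}.
Proof.
move=> cnt sP t tD; have [s' [s'P s'E]] := exists_stable_sort.
have {s' s'P s'E} sE : (s t : nat) = #|[set a in D | before a t]%SET|.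
  by rewrite (stable_sort_unique sP s'P) s'E.
have sD : s t \in D by rewrite (perm_closed _ sP.1).
have down (P : pred int) : (forall x y, x <= y -> P y -> P x) ->
    (s t < #|[set a in D | P (f a)]%SET|)%N = P (g (s t)).
  move=> Pdown; rewrite (card_eq_count cnt) -mem_down_closed ?inE ?sD //.
  move=> a b leab; rewrite !inE => /andP[bD Pb]; rewrite (downD leab bD) /=.
  by apply: Pdown Pb; apply: g_mono.
apply/eqP; rewrite eq_le; apply/andP; split.
  rewrite leNgt -(down (fun x => x < f t)); last by move=> x y; apply: le_lt_trans.
  rewrite -leqNgt sE; apply/subset_leq_card/fintype.subsetP => a.
  by rewrite !inE /before => /andP[-> ->].
rewrite -(down (fun x => x <= f t)); last by move=> x y; apply: le_trans.
rewrite sE; apply/proper_card/fintype.properP; split.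
  apply/fintype.subsetP => a; rewrite !inE /before.
  by move=> /andP[-> /orP[/ltW->|/andP[/eqP->]]] //=.
by exists t; rewrite !inE ?tD ?lexx //= /before ltxx ltnn andbF.
Qed.

End StableSort.

End Permutations.

(** * Length of column permutations *)

Section Columns.

Variables (l : nat) (v : 'I_l -> int).

Lemma leastE (P : nat -> Prop) n :
  P n -> (forall m, P m -> (n <= m)%N) -> least P = n.
Proof.
move=> Pn min_n; rewrite /least; case: xgetP => [m _ [Pm min_m]|].
  by apply/eqP; rewrite eqn_leq min_n // min_m.
by move=> /(_ n) [].
Qed.

Lemma column_down_closed j : multicharge v -> down_closed (column v j).
Proof. by move=> hv a b leab; rewrite !inE => /le_trans; apply; apply: hv. Qed.

(** A simple transposition adds at most one inversion, which bounds every word from below; removing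
    descents one at a time produces a word that reaches the bound. *)
Lemma col_lengthE j (s : 'S_l) : multicharge v -> perm_on (column v j) s ->
  col_length v j s = #|inversions s|.
Proof.
move=> hv sD; apply: leastE => [|_ [w [<- + ->]]]; last first.
  elim: w => [|x w IHw] /=; first by rewrite big_nil inversions1 cards0.
  case/andP => /existsP[k /andP[_ /existsP[m]]] /and3P[_ /eqP mk /eqP ->] /IHw le.
  by rewrite big_cons; apply: leq_trans (card_inversions_tperm_le mk _) _.
move eqn: #|_| => n; elim: n s sD eqn => [|n IHn] s sD eqn.
  exists [::]; split; rewrite // big_nil; apply: inversions_inj.
  by rewrite inversions1; apply/eqP; rewrite -cards_eq0 eqn.
have s1 : s != 1%g by apply: contra_eqN eqn => /eqP ->; rewrite inversions1 cards0.
have [k [m [mk kD mD ltmk]]] := exists_descent (column_down_closed hv) sD s1.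
have [||w [sizew allw eqw]] := IHn (tperm k m * s)%g.
- apply: perm_onM => //; apply: fintype.subset_trans (tperm_on k m) _.
  by apply/fintype.subsetP => x /finset.set2P[] ->.
- have := card_inversions_tperm mk s; rewrite eqn ltmk ltnNge (ltnW ltmk) addn0.
  by rewrite addn1 => -[].
exists (tperm k m :: w); split; rewrite /= ?sizew // ?allw ?andbT.
  apply/existsP; exists k; rewrite kD; apply/existsP; exists m.
  by rewrite mD mk !eqxx.
by rewrite big_cons -eqw mulgA tperm2 mul1g.
Qed.

End Columns.

(** * Quantum integers and the bar involution on scalars *)

Lemma q_neq0 : q != 0.
Proof. by rewrite /q tofrac_eq0 polyX_eq0. Qed.

(** Links the representative on which [bar_scalar] is computed to division in the fraction field. *)
Lemma repr_fracE (x : Qq) :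
  x = tofrac (frac (generic_quotient.repr x)).1 / tofrac (frac (generic_quotient.repr x)).2.
Proof.
have dn0 := denom_ratioP (generic_quotient.repr x).
rewrite -[LHS](generic_quotient.reprK x); unlock tofrac.
rewrite -[X in _ = _ * X]FracField.pi_inv -[RHS]FracField.pi_mul.
rewrite /FracField.mulf /FracField.invf !numden_Ratio ?oner_neq0 //.
by rewrite mulr1 mul1r FracField.Ratio_numden.
Qed.


Local Notation const_frac := (@tofrac {poly rat} \o @polyC rat).

(** A ring morphism out of [rat] coincides with [ratr]; with [const_frac] in its place, substitution
    is visibly multiplicative. *)
Lemma subst_qE x p : subst_q x p = (map_poly const_frac p).[x].
Proof.
rewrite /subst_q; congr horner; apply/polyP => i.
by rewrite !coef_map_id0 ?rmorph0 ?(fmorph_eq_rat const_frac) // /ratr mul0r.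
Qed.

Lemma tofrac_poly_sum (p : {poly rat}) n :
  tofrac (\sum_(i < n) p`_i *: 'X^(n.-1 - i)) = \sum_(i < n) const_frac p`_i * q ^+ (n.-1 - i).
Proof.
rewrite rmorph_sum /=; apply: eq_bigr => i _.
by rewrite -mul_polyC rmorphM rmorphXn.
Qed.

(* q ^+ deg p * p(q^-1) is the reciprocal polynomial, whose value at 0 is the
   leading coefficient of p. *)
Lemma subst_qV_neq0 (p : {poly rat}) : p != 0 -> subst_q q^-1 p != 0.
Proof.
move=> p0; have n0 : (0 < size p)%N by rewrite size_poly_gt0.
have : tofrac (\sum_(i < size p) p`_i *: 'X^((size p).-1 - i)) != 0.
  rewrite tofrac_eq0; apply/eqP => /(congr1 (horner^~ 0)); rewrite horner0 horner_sum.
  have ltn : ((size p).-1 < size p)%N by rewrite prednK.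
  rewrite (bigD1 (Ordinal ltn)) //= subnn hornerZ hornerXn mulr1 big1 ?addr0 => [|i].
    by apply/eqP; rewrite -/(lead_coef p) lead_coef_eq0.
  rewrite -val_eqE /= => nei; rewrite hornerZ hornerXn expr0n subn_eq0 leqNgt.
  have -> : (i < (size p).-1)%N by rewrite ltn_neqAle nei -ltnS prednK // ltn_ord.
  by rewrite mulr0.
rewrite tofrac_poly_sum; apply: contraNneq.
rewrite subst_qE horner_coef size_map_poly => eq0.
rewrite (_ : \sum_(i < _) _ =
    q ^+ (size p).-1 * \sum_(i < size p) (map_poly const_frac p)`_i * q^-1 ^+ i).
  by rewrite eq0 mulr0.
rewrite mulr_sumr; apply: eq_bigr => i _; rewrite coef_map /= mulrCA; congr (_ * _).
by rewrite exprVn expfB_cond // (negPf q_neq0) add0n -ltnS prednK.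
Qed.

(** Two presentations of one fraction satisfy n d' = n' d, an identity that survives the
    substitution of q^-1, and denominators stay nonzero. *)
Lemma bar_scalarE (n d : {poly rat}) : d != 0 ->
  bar_scalar (tofrac n / tofrac d) = subst_q q^-1 n / subst_q q^-1 d.
Proof.
move=> d0; rewrite /bar_scalar; move eqx: (tofrac n / tofrac d) => x.
have := denom_ratioP (generic_quotient.repr x); have := repr_fracE x.
move: (frac _).1 (frac _).2 => n' d' eqx' d'0; move: eqx; rewrite eqx' => /eqP.
rewrite eqr_div ?tofrac_eq0 // -!tofracM tofrac_eq => /eqP eqnd.
apply/eqP; rewrite eqr_div ?subst_qV_neq0 //.
by rewrite !subst_qE -!hornerM -!(rmorphM (map_poly const_frac)) /= eqnd.
Qed.

(** Invariance is witnessed by a presentation, which makes it pass to products and inverses without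
    proving [bar_scalar] multiplicative. *)
Definition bar_invariant (x : Qq) : Prop := exists n d : {poly rat},
  [/\ d != 0, x = tofrac n / tofrac d & x = subst_q q^-1 n / subst_q q^-1 d].

Lemma bar_invariantP x : bar_invariant x -> bar_scalar x = x.
Proof. by case=> n [d [d0 -> eqx]]; rewrite bar_scalarE. Qed.

Lemma bar_invariant1 : bar_invariant 1.
Proof. by exists 1, 1; rewrite oner_neq0 !subst_qE !rmorph1 hornerC divr1. Qed.

Lemma bar_invariantM x y : bar_invariant x -> bar_invariant y -> bar_invariant (x * y).
Proof.
move=> [n [d [d0 ex ex']]] [m [e [e0 ey ey']]]; exists (n * m), (d * e).
split; first by rewrite mulf_neq0.
  by rewrite ex ey mulf_div !rmorphM.
by rewrite {1}ex' {1}ey' mulf_div !subst_qE !rmorphM !hornerM.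
Qed.

Lemma bar_invariantV x : bar_invariant x -> bar_invariant x^-1.
Proof.
move=> [n [d [d0 ex ex']]]; have [n0|n0] := eqVneq n 0.
  exists 0, 1; rewrite oner_neq0 ex n0 !subst_qE !rmorph0 horner0 !mul0r invr0.
  by [].
exists d, n; split=> //; first by rewrite ex invf_div.
by rewrite {1}ex' invf_div.
Qed.

Lemma qX_sub1_neq0 n : (0 < n)%N -> q ^+ n - 1 != 0.
Proof.
move=> n0; have -> : q ^+ n - 1 = tofrac ('X^n - 1) by rewrite tofracB tofracXn tofrac1.
by rewrite tofrac_eq0 -size_poly_gt0 -polyC1 size_XnsubC.
Qed.

Lemma subV_E (K : fieldType) (x : K) : x != 0 -> x - x^-1 = (x ^+ 2 - 1) / x.
Proof. by move=> x0; field. Qed.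

Lemma subV_neq0 (K : fieldType) (x : K) : x != 0 -> x ^+ 2 - 1 != 0 -> x - x^-1 != 0.
Proof. by move=> x0 x2; rewrite subV_E // mulf_neq0 ?invr_neq0. Qed.

Lemma qint_neq0 r : (0 < r)%N -> qint r != 0.
Proof.
move=> r0; apply: mulf_neq0; last apply: invr_neq0.
  apply: subV_neq0; first exact: expf_neq0 q_neq0.
  by rewrite -exprM; apply: qX_sub1_neq0; rewrite muln_gt0 r0.
by apply: subV_neq0; [exact: q_neq0 | exact: qX_sub1_neq0].
Qed.

Lemma qfactS a : qfact a.+1 = qfact a * qint a.+1.
Proof. by rewrite /qfact big_nat_recr. Qed.

Lemma qfact_neq0 a : qfact a != 0.
Proof.
elim: a => [|a IHa]; first by rewrite /qfact big_geq ?oner_neq0.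
by rewrite qfactS mulf_neq0 ?qint_neq0.
Qed.

(** With x = q and y = q ^ r, this presents a quantum integer as a quotient of polynomials. The next
    lemma evaluates that quotient at q^-1: the left side does not change when x and y are both
    inverted. *)
Lemma qint_frac (K : fieldType) (x y : K) : x != 0 -> y != 0 -> x ^+ 2 - 1 != 0 ->
  (y - y^-1) / (x - x^-1) = (x * (y ^+ 2 - 1)) / (y * (x ^+ 2 - 1)).
Proof. by move=> x0 y0 x2; rewrite !subV_E //; field; rewrite x0 y0 x2. Qed.

Lemma qint_fracV (K : fieldType) (x y : K) : x != 0 -> y != 0 -> x ^+ 2 - 1 != 0 ->
  (y - y^-1) / (x - x^-1) = (x^-1 * (y^-1 ^+ 2 - 1)) / (y^-1 * (x^-1 ^+ 2 - 1)).
Proof.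
move=> x0 y0 x2; rewrite -qint_frac ?invr_neq0 //; last first.
  have -> : x^-1 ^+ 2 - 1 = - (x ^+ 2 - 1) / x ^+ 2 by field.
  by rewrite mulf_neq0 ?oppr_eq0 ?invr_neq0 ?expf_neq0.
by rewrite !invrK -(opprB y) -(opprB x) invrN mulrNN.
Qed.

Lemma bar_invariant_qint r : bar_invariant (qint r).
Proof.
have y0 : q ^+ r != 0 := expf_neq0 r q_neq0.
have X2 : 'X^2 - 1 != 0 :> {poly rat} by rewrite -size_poly_gt0 -polyC1 size_XnsubC.
have Xr : 'X^r != 0 :> {poly rat} by rewrite expf_neq0 // polyX_eq0.
exists ('X * (('X^r) ^+ 2 - 1)), ('X^r * ('X^2 - 1)); split.
- exact: mulf_neq0.
- rewrite /qint (qint_frac q_neq0 y0 (@qX_sub1_neq0 2 isT)).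
  by rewrite !(tofracM, tofracB, tofracXn, tofrac1).
rewrite !subst_qE !(rmorphM (map_poly const_frac)) !(rmorphB (map_poly const_frac)).
rewrite !(rmorphXn (map_poly const_frac)) !(rmorph1 (map_poly const_frac)) /= !map_polyX.
rewrite !(hornerM, hornerD, hornerN, horner_exp, hornerX, hornerC).
by rewrite /qint (qint_fracV q_neq0 y0 (@qX_sub1_neq0 2 isT)) -[(q ^+ r)^-1]exprVn !expr2.
Qed.

Lemma bar_invariant_qfact a : bar_invariant (qfact a).
Proof.
rewrite /qfact; apply: (big_ind bar_invariant) => //.
- exact: bar_invariant1.
- exact: bar_invariantM.
- by move=> r _; apply: bar_invariant_qint.
Qed.

(** The sum is the quantum integer of [#|B|], cleared of its denominator. Removing the largest row
    [m] of [B] splits off the top power of x and shifts the other exponents by one. *)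
Lemma qint_sum (K : fieldType) (x : K) (l : nat) (B : {set 'I_l}) : x != 0 ->
  (x - x^-1) * \sum_(t in B) x ^ (#|[set s in B | (s < t)%N]%SET|%:Z
                                  - #|[set s in B | (t < s)%N]%SET|%:Z)
  = x ^+ #|B| - x ^- #|B|.
Proof.
move=> x0; move eqn: #|B| => n; elim: n B eqn => [|n IHn] B eqn.
  by move/eqP: eqn; rewrite cards_eq0 => /eqP ->; rewrite big_set0 mulr0 invr1 subrr.
have /card_gt0P[t0 t0B] : (0 < #|B|)%N by rewrite eqn.
have [m mB max_m] := @arg_maxnP _ t0 (mem B) (fun t : 'I_l => t : nat) t0B.
have {}mB : m \in B by [].
have cardB' : #|B :\ m| = n by have := cardsD1 m B; rewrite mB eqn => -[].
rewrite (big_setD1 m mB) /=.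
have -> : [set s in B | (s < m)%N]%SET = B :\ m.
  apply/setP => s; rewrite !inE andbC; have [sB|] := boolP (s \in B); last by rewrite !andbF.
  by rewrite !andbT ltn_neqAle (max_m s sB : (s <= m)%N) andbT.
have -> : [set s in B | (m < s)%N]%SET = finset.set0.
  apply/setP => s; rewrite !inE; have [sB|//] := boolP (s \in B).
  by rewrite ltnNge (max_m s sB : (s <= m)%N).
rewrite cards0 subr0 cardB'.
rewrite (_ : \sum_(i in B :\ m) _ = x^-1 * \sum_(t in B :\ m)
   x ^ (#|[set s in B :\ m | (s < t)%N]%SET|%:Z - #|[set s in B :\ m | (t < s)%N]%SET|%:Z)).
  rewrite mulrDr (mulrCA _ x^-1) IHn //; rewrite -exprnP exprS.
  have y0 : x ^+ n != 0 by apply: expf_neq0.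
  by field; rewrite x0 y0.
rewrite mulr_sumr; apply: eq_bigr => t; rewrite !inE => /andP[neqtm tB].
have letm : (t < m)%N by rewrite ltn_neqAle neqtm (max_m t tB : (t <= m)%N).
have -> : [set s in B :\ m | (s < t)%N]%SET = [set s in B | (s < t)%N]%SET.
  apply/setP => s; rewrite !inE; case: eqP => //= ->.
  by rewrite [in RHS]ltnNge ltnW // andbF.
rewrite -[x^-1]exprN1 -expfzDr //; congr (x ^ _).
have -> : #|[set s in B | (t < s)%N]%SET| = #|[set s in B :\ m | (t < s)%N]%SET|.+1.
  rewrite (cardsD1 m) !inE mB letm; congr (_.+1); apply: eq_card => s.
  by rewrite !inE andbA.
by rewrite -addn1 PoszD opprD addrA addrC.
Qed.

(** * Coefficients of divided powers *)

Section Lowering.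

Variables (l : nat) (v : 'I_l -> int).
Implicit Types (A : array l) (B C : {set 'I_l}) (i j : int) (t s : 'I_l).

Definition Symbol A (symA : is_symbol v A) : symbol v := exist _ A (asboolT symA).

Lemma symbolP (S : symbol v) : is_symbol v (val S).
Proof. exact/asboolP/(valP S). Qed.

Lemma symbol_lt A t (j k : int) : is_symbol v A -> j <= v t -> k <= v t ->
  (A t j < A t k) = (j < k).
Proof.
move=> symA jt kt; have [mono _ _] := symA t.
apply/idP/idP => [|ltjk]; last exact: mono.
by apply: contraTT; rewrite -!leNgt le_eqVlt => /orP[/eqP->//|ltkj]; rewrite ltW // mono.
Qed.

Lemma symbol_inj A t (j k : int) : is_symbol v A -> j <= v t -> k <= v t ->
  A t j = A t k -> j = k.
Proof.
move=> symA jt kt eqA; have := symbol_lt symA jt kt; have := symbol_lt symA kt jt.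
by rewrite eqA ltxx; case: ltgtP.
Qed.

Lemma has_entryP A t i : reflect (exists2 j, j <= v t & A t j = i) (has_entry v A t i).
Proof. exact: asboolP. Qed.

(* The F_i are used in the transposed form: the coefficients of F_i u at an
   array come from those of u at the arrays where some i + 1 is lowered to i. *)
Definition lower i B A : array l := fun s j =>
  if [&& s \in B, j <= v s & A s j == i + 1] then i else A s j.

Definition lowerable i A : {set 'I_l} :=
  [set t | has_entry v A t (i + 1) && ~~ has_entry v A t i]%SET.

Lemma lower_out i B A s j : s \notin B -> lower i B A s j = A s j.
Proof. by rewrite /lower => /negPf ->. Qed.

Lemma lower_lower i B C A : lower i B (lower i C A) = lower i (B :|: C) A.
Proof.
apply/funext => s; apply/funext => j; rewrite /lower !inE.
case: (s \in B); case: (s \in C) => //=.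
by case: (j <= v s) => //=; case: eqP => //=; case: eqP; rewrite ?if_same.
Qed.

Lemma lowerableP i A t j : t \in lowerable i A -> j <= v t -> A t j != i.
Proof. by rewrite inE => /andP[_ /has_entryP not] jt; apply/eqP => eqi; apply: not; exists j. Qed.

Lemma lower_symbol i B A : is_symbol v A -> B \subset lowerable i A ->
  is_symbol v (lower i B A).
Proof.
move=> symA sub t; have [mono [N eqN] out] := symA t.
have [tB|tB] := boolP (t \in B); last first.
  split=> [j k||j]; rewrite ?lower_out //; [exact: mono | | exact: out].
  by exists N => j; rewrite lower_out //; exact: eqN.
have ne := lowerableP (fintype.subsetP sub _ tB).
split=> [j k ltjk kt||j ltj]; rewrite /lower ?tB /=.
- have jt : j <= v t by rewrite (le_trans (ltW ltjk)).
  have := mono _ _ ltjk kt; have := ne _ jt; have := ne _ kt; rewrite jt kt /=.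
  by move: (A t j) (A t k) => x y; case: (eqVneq x (i + 1)); case: (eqVneq y (i + 1)); lia.
(* In these columns the entry is j <= i, hence is not i + 1 and is not lowered. *)
- exists (Order.min N i) => j; rewrite le_min => /andP[jN ji].
  by rewrite eqN // ifN //; apply/negP; lia.
- by rewrite leNgt ltj /= out.
Qed.

Lemma has_entry_lower_i i B A t : B \subset lowerable i A ->
  has_entry v (lower i B A) t i = (t \in B) || has_entry v A t i.
Proof.
move=> sub; have [tB|tB] /= := boolP (t \in B).
  have := fintype.subsetP sub _ tB; rewrite inE => /andP[/has_entryP[j jt eqj] _].
  by apply/has_entryP; exists j; rewrite // /lower tB jt eqj eqxx.
by apply/has_entryP/has_entryP => -[j jt] eqj; exists j; rewrite // -eqj lower_out.
Qed.

Lemma has_entry_lower_i1 i B A t :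
  has_entry v (lower i B A) t (i + 1) = (t \notin B) && has_entry v A t (i + 1).
Proof.
have [tB|tB] /= := boolP (t \in B).
  apply/has_entryP => -[j jt]; rewrite /lower tB jt /=; case: eqP => //.
  by lia.
by apply/has_entryP/has_entryP => -[j jt] eqj; exists j; rewrite // -eqj lower_out.
Qed.

Lemma lowerable_lower i B A : B \subset lowerable i A ->
  lowerable i (lower i B A) = lowerable i A :\: B.
Proof.
move=> sub; apply/setP => t; rewrite !inE has_entry_lower_i // has_entry_lower_i1.
by case: (t \in B).
Qed.

Lemma raise_lower i t A : is_symbol v A -> t \in lowerable i A ->
  raise_entry v (lower i [set t]%SET A) t i = A.
Proof.
move=> symA tl; apply/funext => s; apply/funext => j; rewrite /raise_entry /lower inE.
have [->|//] /= := eqVneq s t; have [jt|//] /= := boolP (j <= v t).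
have := lowerableP tl jt; case: (eqVneq (A t j) (i + 1)) => [->|_ /negPf->//].
by rewrite eqxx.
Qed.

Section Raise.

Variables (A : array l) (t : 'I_l) (i : int).
Hypotheses (Ai : has_entry v A t i) (Ai1 : ~~ has_entry v A t (i + 1)).

Lemma lowerable_raise : t \in lowerable i (raise_entry v A t i).
Proof.
rewrite inE; apply/andP; split.
  have /has_entryP[j jt eqj] := Ai; apply/has_entryP; exists j => //.
  by rewrite /raise_entry eqxx jt eqj eqxx.
apply/has_entryP => -[j jt]; rewrite /raise_entry eqxx jt /=.
by case: eqP => //; lia.
Qed.

Lemma lower_raise : lower i [set t]%SET (raise_entry v A t i) = A.
Proof.
apply/funext => s; apply/funext => j; rewrite /raise_entry /lower inE.
have [->|//] /= := eqVneq s t; have [jt|//] /= := boolP (j <= v t).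
have [->|_] := eqVneq (A t j) i; first by rewrite eqxx.
by case: eqP => // eqj; case/has_entryP: Ai1; exists j.
Qed.

End Raise.

(** The analogue of [count_below] on arrays, applicable to lowered arrays before they are known to
    be symbols. *)
Definition entries_below A t i : nat := #|[set k : 'I_l | (t < k)%N && has_entry v A k i]%SET|.

Lemma entries_below_lower i t A x :
  entries_below (lower i [set t]%SET A) t x = entries_below A t x.
Proof.
apply: eq_card => k; rewrite !inE; have [ltk|//] /= := ltnP t k.
have kt : k \notin [set t]%SET by rewrite inE -val_eqE neq_ltn ltk orbT.
by apply/has_entryP/has_entryP => -[j jk] <-; exists j; rewrite // lower_out.
Qed.

Definition coef (u : fock v) A : Qq := if insub A is Some T then u@_T else 0.

Lemma coef_val u (T : symbol v) : coef u (val T) = u@_T.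
Proof. by rewrite /coef valK. Qed.

Lemma coef_basis_vec A (W : symbol v) : (basis_vec v A)@_W = (A == val W)%:R.
Proof.
rewrite /basis_vec; case: insubP => [T _ <-|nsym]; first by rewrite mcoeffU val_eqE.
by rewrite mcoeff0; case: eqP => // eqA; rewrite eqA (valP W) in nsym.
Qed.

(** For each row t, at most one symbol contributes to [W]: the one obtained by lowering i + 1 to i
    in row t. The exponent may be read on [W], since it only looks at rows below t. *)
Lemma F_coef i (u : fock v) (W : symbol v) :
  (F i u)@_W = \sum_(t in lowerable i (val W))
     q ^ ((entries_below (val W) t i)%:Z - (entries_below (val W) t (i + 1))%:Z)
     * coef u (lower i [set t]%SET (val W)).
Proof.
pose c (A : array l) t := (entries_below A t i)%:Z - (entries_below A t (i + 1))%:Z.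
rewrite /F raddf_sum /=.
under eq_bigr => S _.
  rewrite mcoeffZ /F_symbol raddf_sum /= mulr_sumr.
  under eq_bigr => t _ do rewrite mcoeffZ coef_basis_vec -/(c (val S) t).
  over.
rewrite (exchange_big_dep xpredT) //= [RHS]big_mkcond /=; apply: eq_bigr => t _.
rewrite big_mkcond /=; case: ifPn => [tl|ntl]; last first.
  apply: big1_seq => S _; case: ifP => // /andP[Si Si1].
  case: eqP => [eqW|]; last by rewrite !mulr0.
  by rewrite -eqW lowerable_raise in ntl.
have symW : is_symbol v (val W) by apply: symbolP.
have tsub : [set t]%SET \subset lowerable i (val W) by rewrite finset.sub1set.
have symL := lower_symbol symW tsub.
pose S0 : symbol v := Symbol symL.
have -> : coef u (lower i [set t]%SET (val W)) = u@_S0.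
  by rewrite -[LHS]/(coef u (val S0)) coef_val.
rewrite (eq_bigr (fun S => if S == S0 then q ^ c (val W) t * u@_S0 else 0)); last first.
  move=> S _; have [->|neS] := eqVneq S S0.
    rewrite /= has_entry_lower_i // has_entry_lower_i1 !inE eqxx /= raise_lower //.
    by rewrite eqxx mulr1 mulrC /c !entries_below_lower.
  case: ifP => // /andP[Si Si1]; case: eqP => [eqW|]; last by rewrite !mulr0.
  by case/eqP: neS; apply: val_inj; rewrite /= -eqW lower_raise.
rewrite -big_mkcond; have [S0u|S0u] := boolP (S0 \in msupp u).
  by rewrite -big_filter (filter_pred1_uniq _ S0u) ?fset_uniq // big_seq1.
by rewrite (mcoeff_outdom S0u) mulr0 big1.
Qed.

Definition unlowered_below B A t i : nat :=
  #|[set k : 'I_l | [&& (t < k)%N, k \notin B & has_entry v A k (i + 1)]]%SET|.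

(* Rows of B below t are not counted: their contributions depend on the order in
   which the rows are lowered, and add up to the factor [a]!. *)
Definition Fdiv_exponent B A i : int :=
  \sum_(t in B) ((entries_below A t i)%:Z - (unlowered_below B A t i)%:Z).

(** Row t is lowered first. The rows of [B] below it still hold i + 1, which subtracts their number;
    each row of [B] above it then sees one more entry i below, which adds theirs. The correction is
    an exponent of [qint_sum]. *)
Lemma Fdiv_exponentD1 B A i t : B \subset lowerable i A -> t \in B ->
  (entries_below A t i)%:Z - (entries_below A t (i + 1))%:Z
    + Fdiv_exponent (B :\ t) (lower i [set t]%SET A) i =
  Fdiv_exponent B A i + (#|[set s in B | (s < t)%N]%SET|%:Z
                         - #|[set s in B | (t < s)%N]%SET|%:Z).
Proof.
move=> sub tB; have tl := fintype.subsetP sub _ tB.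
have tsub : [set t]%SET \subset lowerable i A by rewrite finset.sub1set.
rewrite /Fdiv_exponent [in RHS](big_setD1 t tB) /=.
have -> : (entries_below A t (i + 1) =
    unlowered_below B A t i + #|[set s in B | (t < s)%N]%SET|)%N.
  rewrite /entries_below -[LHS](cardsID B) addnC.
  congr (_ + _)%N; apply: eq_card => k; rewrite !inE.
    by case: (k \in B); case: (t < k)%N.
  have [kB|] := boolP (k \in B); last by rewrite andbF.
  by have := fintype.subsetP sub _ kB; rewrite inE => /andP[-> _]; rewrite !andbT.
have -> : \sum_(s in B :\ t) ((entries_below (lower i [set t]%SET A) s i)%:Z
    - (unlowered_below (B :\ t) (lower i [set t]%SET A) s i)%:Z)
  = \sum_(s in B :\ t) ((entries_below A s i)%:Z - (unlowered_below B A s i)%:Z)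
    + #|[set s in B | (s < t)%N]%SET|%:Z.
  have -> : #|[set s in B | (s < t)%N]%SET| = (\sum_(s in B :\ t) (s < t))%N.
    rewrite -sum1dep_card big_mkcondr (big_setD1 t tB) /= ltnn add0n.
    by apply: eq_bigr => s _; case: (s < t)%N.
  rewrite (big_morph Posz PoszD (erefl 0%:Z)) -big_split.
  apply: eq_bigr => s; rewrite !inE => /andP[nest sB].
  have -> : unlowered_below (B :\ t) (lower i [set t]%SET A) s i = unlowered_below B A s i.
    apply: eq_card => k; rewrite !inE has_entry_lower_i1 !inE negb_and negbK.
    by have [->|] := eqVneq k t; rewrite ?tB ?andbF.
  have -> : entries_below (lower i [set t]%SET A) s i = (entries_below A s i + (s < t))%N.
    rewrite /entries_below (cardsD1 t) addnC !inE has_entry_lower_i // inE eqxx andbT.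
    congr (_ + _)%N; apply: eq_card => k; rewrite !inE has_entry_lower_i // inE.
    have [->|//] := eqVneq k t; rewrite inE in tl.
    by have /andP[_ /negPf ->] := tl; rewrite andbF.
  by rewrite PoszD addrAC.
by rewrite !PoszD; ring.
Qed.

(** By induction on [a], choosing the row t of [B] that is lowered first; for fixed [B], the sum
    over t gives the new quantum integer factor by [qint_sum]. *)
Lemma iterF_coef i a (u : fock v) (W : symbol v) :
  (iter a (F i) u)@_W = qfact a *
    \sum_(B : {set 'I_l} | (B \subset lowerable i (val W)) && (#|B| == a))
      q ^ Fdiv_exponent B (val W) i * coef u (lower i B (val W)).
Proof.
elim: a W => [|a IHa] W.
  rewrite /qfact big_geq // mul1r (big_pred1 finset.set0) => [|B].
    rewrite /Fdiv_exponent big_set0 mul1r -coef_val; congr coef.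
    by apply/funext => s; apply/funext => j; rewrite lower_out ?inE.
  rewrite cards_eq0 andbC /=; case: eqP => [->|//]; exact: finset.sub0set.
rewrite iterS F_coef qfactS.
pose G t (B : {set 'I_l}) :=
  q ^ ((entries_below (val W) t i)%:Z - (entries_below (val W) t (i + 1))%:Z)
  * (qfact a * (q ^ Fdiv_exponent (B :\ t) (lower i [set t]%SET (val W)) i
                * coef u (lower i B (val W)))).
pose P (B : {set 'I_l}) := (B \subset lowerable i (val W)) && (#|B| == a.+1).
transitivity (\sum_(t in lowerable i (val W)) \sum_(B : {set 'I_l} | (t \in B) && P B) G t B).
  apply: eq_bigr => t tl.
  have tsub : [set t]%SET \subset lowerable i (val W) by rewrite finset.sub1set.
  rewrite -[lower _ _ _]/(val (Symbol (lower_symbol (symbolP W) tsub))) coef_val IHa.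
  rewrite -mulr_sumr -mulr_sumr /=; congr (_ * (_ * _)).
  rewrite (reindex_onto (fun B : {set 'I_l} => B :\ t) (fun B : {set 'I_l} => t |: B)) /=
    => [|B /andP[sub _]]; last first.
    apply/setP => s; rewrite !inE; case: eqP => //= ->; apply/esym/negP => tB.
    by have := fintype.subsetP sub _ tB; rewrite lowerable_lower // !inE eqxx.
  apply: eq_big => B.
    rewrite lowerable_lower // subsetD1 !inE eqxx andbT /P.
    have [tB|tB] := boolP (t \in B); last first.
      by rewrite andbC; case: eqP => // eqB; rewrite -eqB !inE eqxx in tB.
    rewrite finset.setD1K // eqxx andbT -[in RHS](finset.setD1K tB) finset.subUset tsub /=.
    by rewrite cardsU1 !inE eqxx.
  move=> /andP[_ /eqP eqB]; rewrite lower_lower; congr (_ * coef _ (lower _ _ _)).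
  by rewrite finset.setUC.
rewrite (exchange_big_dep P) /=; last by move=> t B _ /andP[].
rewrite mulr_sumr; apply: eq_bigr => B /andP[sub /eqP cardB].
rewrite (eq_bigl (mem B)); last first.
  by move=> t; rewrite /P sub cardB eqxx !andbT; apply: andb_idl; apply: (fintype.subsetP sub).
pose e t := #|[set s in B | (s < t)%N]%SET|%:Z - #|[set s in B | (t < s)%N]%SET|%:Z.
transitivity (\sum_(t in B)
  qfact a * (q ^ Fdiv_exponent B (val W) i * coef u (lower i B (val W))) * q ^ e t).
  apply: eq_bigr => t tB; rewrite /G mulrCA -mulrA; congr (_ * _).
  rewrite mulrA -expfzDr ?q_neq0 // Fdiv_exponentD1 // expfzDr ?q_neq0 // -/(e t).
  by rewrite mulrAC.
rewrite -mulr_sumr mulrAC; congr (_ * _ * _).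
rewrite /qint -cardB -(qint_sum B q_neq0) mulrAC mulfV ?mul1r //.
exact: subV_neq0 q_neq0 (@qX_sub1_neq0 2 isT).
Qed.

Lemma Fdiv_coef i a (u : fock v) (W : symbol v) :
  (Fdiv i a u)@_W =
    \sum_(B : {set 'I_l} | (B \subset lowerable i (val W)) && (#|B| == a))
      q ^ Fdiv_exponent B (val W) i * coef u (lower i B (val W)).
Proof. by rewrite /Fdiv mcoeffZ iterF_coef mulKf ?qfact_neq0. Qed.

End Lowering.

(** * Inversions and repeats of a symbol *)

Section FiniteSums.

Variables (I : choiceType) (f g : I -> nat).
Hypotheses (finf : finite_set [set j | f j != 0%N]%classic)
           (fing : finite_set [set j | g j != 0%N]%classic).

Lemma fsum_window : exists r : {fset I},
  [/\ \big[addn/0%N]_(j \in [set: I]%classic) f j = (\sum_(j <- r) f j)%N,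
      \big[addn/0%N]_(j \in [set: I]%classic) g j = (\sum_(j <- r) g j)%N
    & forall j, j \notin r -> f j = 0%N /\ g j = 0%N].
Proof.
have fin : finite_set ([set j | f j != 0%N] `|` [set j | g j != 0%N])%classic.
  by rewrite finite_setU.
have out j : j \notin fset_set ([set j | f j != 0%N] `|` [set j | g j != 0%N])%classic ->
    f j = 0%N /\ g j = 0%N.
  rewrite in_fset_set // notin_setE /= => /not_orP[/negP + /negP].
  by rewrite !negbK => /eqP-> /eqP->.
by exists (fset_set ([set j | f j != 0%N] `|` [set j | g j != 0%N])%classic); split=> //;
  apply: fsbigTE => j /out[].
Qed.

Lemma fsum_local j0 : (forall j, j != j0 -> f j = g j) ->
  (\big[addn/0%N]_(j \in [set: I]%classic) f j + g j0 =
   \big[addn/0%N]_(j \in [set: I]%classic) g j + f j0)%N.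
Proof.
move=> eqfg; have [r [-> -> out]] := fsum_window.
have [j0r|j0r] := boolP (j0 \in r); last first.
  have [-> ->] := out _ j0r.
  rewrite !addn0; apply: eq_bigr => j _; have [->|/eqfg//] := eqVneq j j0.
  by have [-> ->] := out _ j0r.
rewrite !(bigD1_seq j0 j0r) ?fset_uniq //= (eq_bigr _ eqfg).
by rewrite addnAC [RHS]addnAC (addnC (f j0)).
Qed.

Lemma fsum_le : (forall j, (f j <= g j)%N) ->
  (\big[addn/0%N]_(j \in [set: I]%classic) f j <=
   \big[addn/0%N]_(j \in [set: I]%classic) g j)%N.
Proof. by move=> lefg; have [r [-> -> _]] := fsum_window; apply: leq_sum. Qed.

Lemma fsum_eq : (forall j, (f j <= g j)%N) ->
  (\big[addn/0%N]_(j \in [set: I]%classic) g j <=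
   \big[addn/0%N]_(j \in [set: I]%classic) f j)%N ->
  forall j, f j = g j.
Proof.
move=> lefg; have [r [-> -> out]] := fsum_window => le j.
have [jr|/out[-> ->]//] := boolP (j \in r).
move: le; rewrite !(bigD1_seq j jr) ?fset_uniq //= => le.
have le' : (\sum_(i <- r | i != j) f i <= \sum_(i <- r | i != j) g i)%N.
  exact: leq_sum.
by have := lefg j; lia.
Qed.

End FiniteSums.

Section ColumnStatistics.

Variables (l : nat) (v : 'I_l -> int).
Implicit Types (A : array l) (j : int) (t s : 'I_l).

Definition column_inversions A j : {set 'I_l * 'I_l} :=
  [set p : 'I_l * 'I_l | [&& (p.1 < p.2)%N, p.2 \in column v j & A p.2 j < A p.1 j]]%SET.

Definition column_repeats A j : {set 'I_l * 'I_l} :=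
  [set p : 'I_l * 'I_l | [&& (p.1 < p.2)%N, p.2 \in column v j & A p.1 (j - 1) == A p.2 j]]%SET.

Definition inversion_stat A : nat :=
  \big[addn/0%N]_(j \in [set: int]%classic) #|column_inversions A j|.

Definition exponent A : int := (inversion_stat A)%:Z - (Mstat v A)%:Z.

(* Equality of columns as multisets: A is obtained from A' by a column permutation. *)
Definition same_columns A A' : Prop := forall j (x : int),
  #|[set t in column v j | A t j == x]%SET| = #|[set t in column v j | A' t j == x]%SET|.

Definition sorted_columns A : Prop := forall j (a b : 'I_l),
  (a <= b)%N -> b \in column v j -> A a j <= A b j.

Lemma Mstat_repeats A :
  Mstat v A = \big[addn/0%N]_(j \in [set: int]%classic) #|column_repeats A j|.
Proof.
apply: eq_fsbigr => j _; rewrite -sum1dep_card.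
under eq_bigr => t _ do rewrite -sum1dep_card.
rewrite (exchange_big_dep xpredT) //= pair_big_dep /=; apply: eq_bigl => -[s t] /=.
by rewrite andbCA.
Qed.

Lemma symbol_trivial A : is_symbol v A ->
  exists N, forall t j, j <= N -> A t j = j.
Proof.
move=> symA; have /choice[N NP] : forall t, exists N, forall j, j <= N -> A t j = j.
  by move=> t; have [_ ] := symA t.
(* Minus a sum of absolute values lies below every [N t]. *)
exists (- (\sum_t `|N t|)) => t j le; apply: NP; apply: le_trans le _.
rewrite lerNl (bigD1 t) //=.
have : 0 <= \sum_(s | s != t) `|N s| by apply: sumr_ge0.
by move: (\sum_(s | _) _) => x; lia.
Qed.

Lemma finite_int_interval (N M : int) : finite_set [set j | N < j <= M]%classic.
Proof.
apply: (@sub_finite_set _ _ ((fun n : nat => N + n%:Z) @` `I_(`|M - N|%N.+1))%classic).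
  move=> j /= /andP[lt le]; exists `|j - N|%N => /=; lia.
exact/finite_image/finite_II.
Qed.

Lemma column_empty : exists M, forall j, M < j -> column v j = finset.set0.
Proof.
exists (\sum_t `|v t|) => j lt; apply/setP => t; rewrite !inE; apply/negbTE.
rewrite -ltNge; apply: le_lt_trans lt; rewrite (bigD1 t) //=.
by rewrite (le_trans (ler_norm _)) // lerDl sumr_ge0.
Qed.

Lemma finite_inversions A : is_symbol v A ->
  finite_set [set j | #|column_inversions A j| != 0%N]%classic.
Proof.
move=> /symbol_trivial[N NP]; have [M MP] := column_empty.
apply: sub_finite_set (finite_int_interval N M) => j /=; apply: contraNP => /negP.
rewrite negb_and -leNgt -ltNge => /orP[jN|Mj]; rewrite cards_eq0; apply/eqP/setP => -[s t];
  rewrite !inE /=; first by rewrite !NP // ltxx !andbF.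
by have /setP/(_ t) := MP _ Mj; rewrite !inE => ->; rewrite andbF.
Qed.

Lemma finite_repeats A : is_symbol v A ->
  finite_set [set j | #|column_repeats A j| != 0%N]%classic.
Proof.
move=> /symbol_trivial[N NP]; have [M MP] := column_empty.
apply: sub_finite_set (finite_int_interval N M) => j /=; apply: contraNP => /negP.
rewrite negb_and -leNgt -ltNge => /orP[jN|Mj]; rewrite cards_eq0; apply/eqP/setP => -[s t];
  rewrite !inE /=.
  by rewrite !NP //; lia.
by have /setP/(_ t) := MP _ Mj; rewrite !inE => ->; rewrite andbF.
Qed.

Hypothesis hv : multicharge v.

Lemma repeats_sub_inversions A j : is_symbol v A ->
  column_repeats A j \subset column_inversions A j.
Proof.
move=> symA; apply/fintype.subsetP => -[s t]; rewrite !inE /= => /and3P[ltst tj /eqP<-].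
rewrite ltst tj /=; have [mono _ _] := symA s; apply: mono; first by lia.
by apply: le_trans tj _; apply: hv; apply: ltnW.
Qed.

Lemma exponent_ge0 A : is_symbol v A -> 0 <= exponent A.
Proof.
move=> symA; rewrite subr_ge0 lez_nat Mstat_repeats.
apply: fsum_le => [||j]; [exact: finite_repeats|exact: finite_inversions|].
exact/subset_leq_card/repeats_sub_inversions.
Qed.

(* If the exponent vanishes, an inversion of column j is a repeat, hence also an
   inversion of column j - 1; descending, it would persist in trivial columns. *)
Lemma exponent_eq0 A j : is_symbol v A -> exponent A = 0 -> column_inversions A j = finset.set0.
Proof.
move=> symA exp0; have eqcol k : column_repeats A k = column_inversions A k.
  apply/eqP; rewrite eqEcard repeats_sub_inversions //=.
  rewrite (fsum_eq (finite_repeats symA) (finite_inversions symA)) //.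
    by move=> i; apply/subset_leq_card/repeats_sub_inversions.
  by move/eqP: exp0; rewrite /exponent Mstat_repeats subr_eq0 => /eqP[eqS]; rewrite -eqS.
apply/setP => -[s t]; rewrite [RHS]inE; apply/negP => inv.
have desc n : (s, t) \in column_inversions A (j - n%:Z).
  elim: n => [|n IHn]; first by rewrite subr0.
  have := IHn; rewrite -eqcol !inE /= => /and3P[-> tj /eqP eqr].
  have -> : j - n.+1%:Z = j - n%:Z - 1 by lia.
  rewrite eqr; have [mono _ _] := symA t; rewrite mono ?andbT //; lia.
have [N NP] := symbol_trivial symA.
have := desc `|j - N|%N; rewrite !inE /= !NP ?ltxx ?andbF //; lia.
Qed.

(** Without inversions the stable sort of each column is the identity, so the column already equals
    its sorted rearrangement. *)
Lemma same_columns_sorted A S : is_symbol v A -> is_symbol v S ->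
  sorted_columns S -> same_columns A S ->
  (forall j, column_inversions A j = finset.set0) -> A = S.
Proof.
move=> symA symS sortS same inv0; apply/funext => t; apply/funext => j.
have [tj|tj] := boolP (t \in column v j); last first.
  have [_ _ outA] := symA t; have [_ _ outS] := symS t.
  by rewrite inE -ltNge in tj; rewrite outA ?outS.
have downj := @column_down_closed _ _ j hv.
have [s [[sD inv_s] _]] := exists_stable_sort (fun t => A t j) downj.
have s1 : s = 1%g by apply: inversions_inj; rewrite inv_s inversions1 -(inv0 j).
have := @stable_sortE _ _ (fun t => A t j) downj (fun t => S t j) (@sortS j) s (same j).
by move=> /(_ (conj sD inv_s) t tj); rewrite s1 perm1.
Qed.

End ColumnStatistics.

(** * Raising one column *)

Lemma card_set_pairs (l : nat) (B : {set 'I_l}) (Q : 'I_l -> 'I_l -> bool) :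
  #|[set p : 'I_l * 'I_l | (p.1 \in B) && Q p.1 p.2]%SET| =
  (\sum_(s in B) #|[set t | Q s t]%SET|)%N.
Proof.
rewrite -sum1dep_card; under [RHS]eq_bigr => s _ do rewrite -sum1dep_card.
by rewrite pair_big_dep.
Qed.

Section LowerColumn.

Variables (l : nat) (v : 'I_l -> int) (j i : int).
Hypothesis hv : multicharge v.
Implicit Types (A W : array l) (t s : 'I_l).

Lemma same_columns_mem A A' t k : same_columns v A A' -> k <= v t ->
  exists2 s, k <= v s & A' s k = A t k.
Proof.
move=> same kt; have : (0 < #|[set s in column v k | A s k == A t k]%SET|)%N.
  by rewrite card_gt0; apply/set0Pn; exists t; rewrite !inE kt eqxx.
rewrite same card_gt0 => /set0Pn[s]; rewrite !inE => /andP[ks /eqP eqA].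
by exists s.
Qed.

Lemma same_columns_sym A A' : same_columns v A A' -> same_columns v A' A.
Proof. by move=> same k x; rewrite same. Qed.

Definition movable A : {set 'I_l} := [set t in column v j | A t j == i + 1]%SET.

Lemma lower_movable_on A t : j <= v t ->
  lower v i (movable A) A t j = if A t j == i + 1 then i else A t j.
Proof. by move=> jt; rewrite /lower !inE jt /=; case: eqP. Qed.

(** [lower] acts on whole rows, but in a movable row the value i + 1 stands in column j, hence in no
    other. *)
Lemma lower_movable_off A t k : is_symbol v A -> k != j ->
  lower v i (movable A) A t k = A t k.
Proof.
move=> symA /eqP nekj; rewrite /lower !inE.
case: ifP => // /and3P[/andP[jt /eqP eqj] kt /eqP eqk]; case: nekj.
by apply: (symbol_inj symA kt jt); rewrite eqk eqj.
Qed.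

Lemma card_lower_value (D : {set 'I_l}) (f : 'I_l -> int) (x : int) :
  #|[set t in D | (if f t == i + 1 then i else f t) == x]%SET| =
  if x == i then (#|[set t in D | f t == i]%SET| + #|[set t in D | f t == (i + 1)%R]%SET|)%N
  else if x == i + 1 then 0%N else #|[set t in D | f t == x]%SET|.
Proof.
case: eqVneq => [->|nxi].
  rewrite -[LHS](cardsID [set t | f t == i]%SET); congr (_ + _)%N; apply: eq_card => t;
    rewrite !inE; case: (t \in D); rewrite ?andbF //=.
    by case: (eqVneq (f t) (i + 1)) => [->|]; rewrite ?eqxx ?andbb //; lia.
  by case: (eqVneq (f t) (i + 1)) => [->|]; rewrite ?eqxx ?andbb ?andNb //=; lia.
case: eqVneq => [->|nxi1].
  apply/eqP; rewrite cards_eq0; apply/eqP/setP => t; rewrite !inE.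
  by case: (t \in D) => //=; case: (eqVneq (f t) (i + 1)); lia.
apply: eq_card => t; rewrite !inE; case: (t \in D) => //=.
by case: (eqVneq (f t) (i + 1)) => // ->; lia.
Qed.

(* Column j has just been raised by F_i: the columns before it have not moved yet,
   those after it are in their final position. *)
Record lower_profile A : Prop := LowerProfile {
  profile_trivial : forall t k, k < j -> k <= v t -> A t k = k;
  profile_max : forall t, j <= v t -> A t j <= i + 1;
  profile_later : forall t k, j < k -> k <= v t -> i + 1 <= A t k }.

Lemma same_columns_profile A A' : same_columns v A A' -> lower_profile A -> lower_profile A'.
Proof.
move=> /same_columns_sym same [triv max later].
split=> [t k ltk kt|t jt|t k ltk kt].
- by have [s ks <-] := same_columns_mem same kt; apply: triv.
- by have [s ks <-] := same_columns_mem same jt; apply: max.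
- by have [s ks <-] := same_columns_mem same kt; apply: later.
Qed.

Hypothesis leji : j <= i.

Let ltj1 : j < j + 1. Proof. by lia. Qed.

Section Profile.

Variable W : array l.
Hypotheses (symW : is_symbol v W) (proW : lower_profile W).

(** Columns before j hold values less than j <= i, and those after j hold values at least i + 1. *)
Lemma has_entry_iE t : has_entry v W t i = (j <= v t) && (W t j == i).
Proof.
apply/has_entryP/andP => [[k kt eqk]|[jt /eqP]]; last by exists j.
have [ltkj|ltjk|eqkj] := ltgtP k j.
- by move: eqk; rewrite (profile_trivial proW) //; lia.
- by have := profile_later proW ltjk kt; rewrite eqk; lia.
- by rewrite -eqkj kt eqk.
Qed.

(** A row is at least i + 1 in column j + 1, hence larger than i + 1 further right. *)
Lemma has_entry_i1E t : has_entry v W t (i + 1) =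
  (t \in movable W) || (j + 1 <= v t) && (W t (j + 1) == i + 1).
Proof.
apply/has_entryP/orP => [[k kt eqk]|]; last first.
  by rewrite !inE => -[/andP[jt /eqP]|/andP[jt /eqP]]; [exists j|exists (j + 1)].
rewrite !inE; have [ltkj|ltjk|eqkj] := ltgtP k j; last by rewrite -eqkj kt eqk eqxx; left.
  by move: eqk; rewrite (profile_trivial proW) //; lia.
have j1t : j + 1 <= v t by lia.
have [ek|ne] := eqVneq k (j + 1); first by right; rewrite j1t -ek eqk eqxx.
have [mono _ _] := symW t; have := mono (j + 1) k _ kt.
by have := profile_later proW ltj1 j1t; rewrite eqk; lia.
Qed.

Lemma movable_sub : movable W \subset lowerable v i W.
Proof.
apply/fintype.subsetP => t tm; rewrite inE has_entry_i1E tm has_entry_iE /=.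
by move: tm; rewrite !inE => /andP[-> /eqP->] /=; lia.
Qed.

Let U := lower v i (movable W) W.

Let symU : is_symbol v U.
Proof. exact: lower_symbol symW movable_sub. Qed.

(** Since i + 1 bounds column j and all its occurrences there are lowered together, exactly the
    inversions between i + 1 and i disappear. *)
Lemma card_inversions_lower :
  #|column_inversions v W j| =
  (#|column_inversions v U j| + \sum_(t in movable W) entries_below v W t i)%N.
Proof.
rewrite -[LHS](cardsID [set p : 'I_l * 'I_l | (p.1 \in movable W) && (W p.2 j == i)]%SET).
rewrite addnC; congr (_ + _)%N.
  apply: eq_card => -[s t]; rewrite !inE /=.
  have [ltst|] := ltnP s t; rewrite ?andbF //=.
  have [jt|] := boolP (j <= v t); rewrite ?andbF //=.
  have js : j <= v s by apply: le_trans jt _; apply: hv; apply: ltnW.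
  rewrite js /U !lower_movable_on //.
  have := profile_max proW js; have := profile_max proW jt.
  move: (W s j) (W t j) => x y; case: (eqVneq x (i + 1)); case: (eqVneq y (i + 1)); lia.
rewrite /entries_below -card_set_pairs; apply: eq_card => -[s t]; rewrite !inE /= has_entry_iE.
have [ltst|] := ltnP s t; rewrite ?andbF //=.
have [jt|] := boolP (j <= v t); rewrite ?andbF //=.
have js : j <= v s by apply: le_trans jt _; apply: hv; apply: ltnW.
by rewrite js /=; lia.
Qed.

(** Repeats of column j + 1 have value at least i + 1, so they need an i + 1 in column j, and all
    are lost. In a row below a movable one, an i + 1 outside the movable rows lies in column j +
    1. *)
Lemma card_repeats_lower :
  #|column_repeats v W (j + 1)| =
  (#|column_repeats v U (j + 1)| + \sum_(t in movable W) unlowered_below v (movable W) W t i)%N.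
Proof.
rewrite -[LHS](cardsID [set p : 'I_l * 'I_l | p.1 \in movable W]%SET).
rewrite addnC; congr (_ + _)%N.
  apply: eq_card => -[s t]; rewrite !inE /= addrK.
  have [ltst|] := ltnP s t; rewrite ?andbF //=.
  have [jt|] := boolP (j + 1 <= v t); rewrite ?andbF //=.
  have js : j <= v s by have := hv (ltnW ltst); lia.
  rewrite js /U lower_movable_on // lower_movable_off //=; last by lia.
  have := profile_later proW ltj1 jt.
  move: (W s j) (W t _) => x y; case: (eqVneq x (i + 1)); lia.
rewrite /unlowered_below -card_set_pairs; apply: eq_card => -[s t].
rewrite [LHS]inE [RHS]inE /= [in RHS]inE has_entry_i1E inE.
have [sm|] := boolP (s \in movable W); last by rewrite !inE => /negPf ->; rewrite !andbF.
rewrite !inE /= addrK.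
have [ltst|] := ltnP s t; rewrite ?andbF //=.
move: sm; rewrite !inE => /andP[js /eqP ->].
have [j1t|] := boolP (j + 1 <= v t); rewrite ?andbF ?orbF ?andNb ?andbF //=.
have jt : j <= v t by lia.
rewrite jt /=; have [mono _ _] := symW t; have := mono j (j + 1) _ j1t.
by move: (W t j) (W t (j + 1)) => x y; lia.
Qed.

(** Only the inversions of column j and the repeats of column j + 1 change; these changes are the
    two sums that make up [Fdiv_exponent]. *)
Lemma exponent_lower :
  exponent v W = exponent v U + Fdiv_exponent v (movable W) W i.
Proof.
have inv : (inversion_stat v W =
    inversion_stat v U + \sum_(t in movable W) entries_below v W t i)%N.
  have := @fsum_local _ _ _ (finite_inversions symW) (finite_inversions symU) j.
  rewrite -!/(inversion_stat _ _) card_inversions_lower => H.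
  have : (inversion_stat v W + #|column_inversions v U j| = inversion_stat v U +
     (#|column_inversions v U j| + \sum_(t in movable W) entries_below v W t i))%N.
    apply: H => k nek; apply: eq_card => -[s t]; rewrite !inE /U.
    by rewrite !lower_movable_off.
  lia.
have rep : (Mstat v W =
    Mstat v U + \sum_(t in movable W) unlowered_below v (movable W) W t i)%N.
  have := @fsum_local _ _ _ (finite_repeats symW) (finite_repeats symU) (j + 1).
  rewrite -!Mstat_repeats card_repeats_lower => H.
  have : (Mstat v W + #|column_repeats v U (j + 1)| = Mstat v U +
     (#|column_repeats v U (j + 1)| + \sum_(t in movable W) unlowered_below v (movable W) W t i))%N.
    apply: H => k nek; apply: eq_card => -[s t]; rewrite !inE /U.
    have [->|nekj] := eqVneq k j; last first.
      by rewrite !lower_movable_off //; apply/eqP => e; case/eqP: nek; lia.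
    (* Column j has no repeats, before or after lowering: column j - 1 is constantly j - 1, and the
       entries of column j are larger. *)
    have [ltst|] := ltnP s t; rewrite //=; have [jt|] := boolP (j <= v t); rewrite //=.
    have jt' : j - 1 <= v t by lia.
    have js' : j - 1 <= v s by have := hv (ltnW ltst); lia.
    have ltj : j - 1 < j by lia.
    have ne : j - 1 != j by lia.
    have [monoW _ _] := symW t; have [monoU _ _] := symU t.
    have := monoW _ _ ltj jt; have := monoU _ _ ltj jt.
    rewrite /U !(lower_movable_off _ symW ne) (profile_trivial proW ltj js')
      (profile_trivial proW ltj jt').
    by move=> ltU ltW; rewrite (lt_eqF ltW) (lt_eqF ltU).
  by rewrite addnCA (addnC (Mstat v W)) => /addnI.
rewrite /exponent inv rep /Fdiv_exponent sumrB.
by rewrite !PoszD !(big_morph Posz PoszD (erefl 0%:Z)) opprD addrACA.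
Qed.

End Profile.

Section Step.

Variable S : array l.
Hypotheses (symS : is_symbol v S) (proS : lower_profile S).

Let T := lower v i (movable S) S.

Lemma card_lower_movable A (x : int) :
  #|[set t in column v j | lower v i (movable A) A t j == x]%SET| =
  if x == i then (#|[set t in column v j | A t j == i]%SET| + #|movable A|)%N
  else if x == i + 1 then 0%N else #|[set t in column v j | A t j == x]%SET|.
Proof.
rewrite -(card_lower_value _ (fun t => A t j)); apply: eq_card => t; rewrite !inE.
by have [jt|//] := boolP (j <= v t); rewrite /= lower_movable_on.
Qed.

Lemma card_lower_movable_off A k (x : int) : is_symbol v A -> k != j ->
  #|[set t in column v k | lower v i (movable A) A t k == x]%SET| =
  #|[set t in column v k | A t k == x]%SET|.
Proof. by move=> symA nek; apply: eq_card => t; rewrite !inE lower_movable_off. Qed.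

Lemma same_columns_lower W : is_symbol v W -> same_columns v W S ->
  same_columns v (lower v i (movable W) W) T.
Proof.
move=> symW same k x; have [->|nek] := eqVneq k j; last first.
  by rewrite !card_lower_movable_off.
by rewrite !card_lower_movable /movable !same.
Qed.

(** An i + 1 lowered outside column j would put the value i in a column of [T] that lacks it, and
    one left in column j would be a value that column j of [T] no longer has. *)
Lemma lower_same_columns W (B : {set 'I_l}) : is_symbol v W -> B \subset lowerable v i W ->
  #|B| = #|movable S| -> same_columns v (lower v i B W) T ->
  same_columns v W S /\ B = movable W.
Proof.
move=> symW sub cardB same; have eqB : B = movable W.
  apply/setP => t; apply/idP/idP => tm.
    have := fintype.subsetP sub _ tm; rewrite inE => /andP[/has_entryP[k kt eqk] _].
    have [s ks] := same_columns_mem same kt.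
    rewrite [lower v i B W t k]/lower tm kt eqk eqxx /= => eqT.
    suff ekj : k = j by rewrite !inE -ekj kt eqk eqxx.
    have [ltkj|ltjk|//] := ltgtP k j.
      by move: eqT; rewrite /T lower_movable_off ?lt_eqF // (profile_trivial proS ltkj ks); lia.
    move: eqT; rewrite /T lower_movable_off ?gt_eqF //.
    by have := profile_later proS ltjk ks; move: (S s k) => y; lia.
  apply: contraT => tB; move: tm; rewrite !inE => /andP[jt /eqP eqj].
  have [s js] := same_columns_mem same jt; rewrite [lower v i B W t j]lower_out // eqj.
  rewrite /T lower_movable_on //; have := profile_max proS js.
  by case: (eqVneq (S s j) (i + 1)); lia.
split=> // k x; rewrite eqB in same.
have [->|nek] := eqVneq k j; last first.
  by have := same k x; rewrite !card_lower_movable_off.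
(* Lowering merges the values i + 1 and i; the cardinal of [B] restores their separate counts. *)
have eqi1 : #|movable W| = #|movable S| by rewrite -eqB.
have [->|nei1] := eqVneq x (i + 1); first exact: eqi1.
have := same j x; rewrite !card_lower_movable (negPf nei1).
by case: eqP => // ->; rewrite eqi1 => /addIn.
Qed.

(** The expected formula for G(A), indexed by the rearrangements of the columns of [A] instead of
    permutations. *)
Definition is_expansion (g : fock v) A : Prop := forall W : symbol v,
  g@_W = if `[< same_columns v (val W) A >] then q ^ exponent v (val W) else 0.

(** In [Fdiv_coef] at [W], only [B = movable W] can contribute, and only when [W] has the columns of
    [S]. *)
Lemma Fdiv_step g : is_expansion g T -> is_expansion (Fdiv i #|movable S| g) S.
Proof.
move=> gT W; have symW := symbolP W; rewrite Fdiv_coef.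
have coefE (B : {set 'I_l}) : B \subset lowerable v i (val W) -> coef g (lower v i B (val W)) =
    if `[< same_columns v (lower v i B (val W)) T >]
    then q ^ exponent v (lower v i B (val W)) else 0.
  by move=> sub; rewrite -[lower _ _ _ _]/(val (Symbol (lower_symbol symW sub))) coef_val gT.
case: asboolP => [same|nsame]; last first.
  apply: big1 => B /andP[sub /eqP cardB]; rewrite coefE //.
  case: asboolP => [same|_]; last by rewrite mulr0.
  by case: nsame; have [] := lower_same_columns symW sub cardB same.
have proW := same_columns_profile (same_columns_sym same) proS.
have msub := movable_sub symW proW.
rewrite (bigD1 (movable (val W))) /=; last by rewrite msub /movable same eqxx.
rewrite big1 => [|B /andP[/andP[sub /eqP cardB] /eqP neB]].
  rewrite addr0 coefE // asboolT; last exact: same_columns_lower.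
  by rewrite (exponent_lower symW proW) addrC -expfzDr ?q_neq0.
rewrite coefE //; case: asboolP => [sameB|_]; last by rewrite mulr0.
by case: neB; have [] := lower_same_columns symW sub cardB sameB.
Qed.

End Step.

End LowerColumn.

(** * Ordered symbols as monomials *)

Section OrderedArrays.

Variables (l : nat) (v : 'I_l -> int).
Hypothesis hv : multicharge v.
Implicit Types (A : array l) (s t : 'I_l) (j k : int).

Record ordered_array A : Prop := OrderedArray {
  ordered_symbol : is_symbol v A;
  ordered_sorted : sorted_columns v A;
  ordered_columns : forall s t j k, j < k -> j <= v s -> k <= v t -> A s j <= A t k }.

(** Columns j < k are compared through the top row: its entry in column j + 1 bounds column j, grows
    along the row up to column k, and is the least entry there. *)
Lemma ordered_arrayP (S : symbol v) : ordered S -> ordered_array (val S).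
Proof.
move=> [stdS ordS]; have symS := symbolP S.
have sorted n : forall (a b : 'I_l) j, (a + n)%N = b -> j <= v b -> val S a j <= val S b j.
  elim: n => [|n IHn] a b j eqb jb; first by rewrite (_ : a = b) //; apply: val_inj => /=; lia.
  have ltb : (b.-1 < l)%N by have := ltn_ord b; lia.
  apply: (@le_trans _ _ (val S (Ordinal ltb) j)); last by apply: stdS => //=; lia.
  by apply: IHn => /=; [lia | apply: le_trans jb _; apply: hv => /=; lia].
have sortS : sorted_columns v (val S).
  by move=> j a b leab; rewrite inE; apply: (sorted (b - a)%N); lia.
split=> // s t j k ltjk js kt.
have l0 : (0 < l)%N by apply: leq_ltn_trans (ltn_ord s).
pose r := Ordinal l0; have kr : k <= v r by apply: le_trans kt _; apply: hv.
apply: (@le_trans _ _ (val S r (j + 1))).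
  by have := ordS r s (j + 1) erefl; rewrite addrK; apply; rewrite ?addrK //; lia.
apply: (@le_trans _ _ (val S r k)); last by apply: sortS; rewrite ?inE.
have [ltj1k|lekj1] := ltP (j + 1) k; last by rewrite (_ : k = j + 1) //; lia.
by have [mono _ _] := symS r; apply: ltW; apply: mono.
Qed.

Lemma sorted_inversions A j : sorted_columns v A -> column_inversions v A j = finset.set0.
Proof.
move=> sortA; apply/setP => -[s t]; rewrite inE [RHS]inE /=; apply/negP => /and3P[ltst tj].
by rewrite ltNge sortA // ltnW.
Qed.

Lemma exponent_sorted A : is_symbol v A -> sorted_columns v A -> exponent v A = 0.
Proof.
move=> symA sortA; apply/eqP; rewrite eq_le exponent_ge0 // andbT /exponent.
rewrite (_ : inversion_stat v A = 0%N) ?sub0r ?oppr_le0 //.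
by apply: fsbig1 => j _; rewrite sorted_inversions // cards0.
Qed.

(** Base of the induction: a symbol whose columns are all trivial is the empty one, which is sorted
    and so has exponent 0. *)
Lemma empty_expansion A : (forall t k, k <= v t -> A t k = k) ->
  is_expansion (vacuum v) A.
Proof.
move=> trivA W; rewrite /vacuum mcoeffU.
have [<-|neW] := eqVneq (empty_symbol v) W.
  rewrite asboolT => [|k x]; last first.
    by apply: eq_card => t; rewrite !inE /= /empty_array; case: ifP => //= kt; rewrite trivA.
  rewrite exponent_sorted //; first exact: symbolP.
  move=> j a b leab; rewrite inE /= /empty_array => jb.
  by rewrite jb (le_trans jb (hv leab)).
rewrite asboolF // => same; case/eqP: neW; apply: val_inj; apply/funext => t; apply/funext => k.
have [_ _ out] := symbolP W t; rewrite /= /empty_array; case: ifPn => kt; last first.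
  by rewrite out // ltNge.
by have [s ks <-] := same_columns_mem same kt; rewrite trivA.
Qed.

(* Invariant of the induction ensuring that successive letters of the word differ. *)
Definition head_raises (w : seq (int * nat)) A : Prop :=
  if w is (i, _) :: _ then exists t k, [/\ k <= v t, A t k = i + 1, k < i + 1
      & forall s k', k' < k -> k' <= v s -> A s k' = k']
  else True.

Section Lower.

Variables (A : array l) (j i : int).
Hypotheses (ordA : ordered_array A) (leji : j <= i) (proA : lower_profile v j i A).

Let symA : is_symbol v A := ordered_symbol ordA.
Let T := lower v i (movable v j i A) A.

Let T_on t : j <= v t -> T t j = if A t j == i + 1 then i else A t j.
Proof. exact: lower_movable_on. Qed.

Let T_off t k : k != j -> T t k = A t k.
Proof. by move=> nek; apply: lower_movable_off. Qed.

Lemma lower_profile_ge t : j <= v t -> j <= A t j.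
Proof.
move=> jt; have [mono _ _] := symA t.
have ltj : j - 1 < j by lia.
have jt' : j - 1 <= v t by lia.
by have := mono _ _ ltj jt; rewrite (profile_trivial proA ltj jt'); lia.
Qed.

(** All the maximal entries of column j are lowered at once, so it stays sorted; its entries remain
    at least j, above the trivial columns on the left. *)
Lemma lower_ordered : ordered_array T.
Proof.
split=> [|k a b leab bk|s t j' k ltjk js kt].
- by apply: lower_symbol => //; apply: movable_sub.
- have := ordered_sorted ordA leab bk; move: bk; rewrite inE => kb.
  have [ekj|nek] := eqVneq k j; last by rewrite !T_off.
  rewrite ekj in kb *; rewrite !T_on //; last by apply: le_trans kb _; apply: hv.
  have := profile_max proA kb.
  by case: (eqVneq (A a j) (i + 1)); case: (eqVneq (A b j) (i + 1)); lia.
- have := ordered_columns ordA ltjk js kt.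
  have [ekj|nek] := eqVneq k j.
    have ltj : j' < j by rewrite -ekj.
    rewrite ekj in kt *; rewrite (T_off _ (_ : j' != j)) ?lt_eqF // T_on //.
    rewrite (profile_trivial proA ltj js); have := lower_profile_ge kt.
    by case: ifP; lia.
  rewrite (T_off _ nek); have [ejj|nej] := eqVneq j' j; last by rewrite T_off.
  by rewrite ejj in js ltjk *; rewrite T_on //; case: eqP; lia.
Qed.

Lemma head_raises_cons (w : seq (int * nat)) a : (exists t, t \in movable v j i A) ->
  sorted (fun x y => x.1 != y.1) w -> head_raises w T ->
  sorted (fun x y => x.1 != y.1) ((i, a) :: w) /\ head_raises ((i, a) :: w) A.
Proof.
move=> [t tm] sorted_w head_w; have := tm; rewrite !inE => /andP[jt /eqP eqt].
split; last first.
  by exists t, j; split=> //; [lia | move=> s k ltk ks; exact: (profile_trivial proA ltk ks)].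
case: w sorted_w head_w => [//|[i' a'] w] /= -> [t' [k [kt' eqk ltk trivT]]].
rewrite andbT; apply/eqP => eqi; rewrite -{i'}eqi in eqk ltk.
(* If the next letter were i again, [T] would hold i + 1 in a column k < i + 1 preceded by trivial
   ones. Left of j the columns are trivial, and column j has no i + 1 left; if k > j, column j of
   [T] is trivial, so i = j and k >= i + 1. *)
have [ltkj|ltjk|ekj] := ltgtP k j.
- by move: eqk; rewrite T_off ?lt_eqF // (profile_trivial proA ltkj kt'); lia.
- by have := trivT t j ltjk jt; rewrite T_on // eqt eqxx; lia.
- rewrite ekj in kt' eqk; move: eqk; rewrite T_on //.
  by case: eqP => // _; lia.
Qed.

End Lower.

(** The decreasing measure of the induction: the distance to the trivial entries over a window of
    [n] columns starting at [N]. Lowering leaves the dummy entries alone, so their contribution is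
    constant. *)
Definition displacement (N : int) (n : nat) A : nat :=
  (\sum_t \sum_(m < n) `|(A t (N + m%:Z) - (N + m%:Z))%R|)%N.

Lemma ltn_sum (I : finType) (f g : I -> nat) x0 :
  (forall x, (f x <= g x)%N) -> (f x0 < g x0)%N -> (\sum_x f x < \sum_x g x)%N.
Proof.
move=> lefg lt0; rewrite (bigD1 x0) //= [X in (_ < X)%N](bigD1 x0) //=.
by rewrite -addSn leq_add // leq_sum.
Qed.

Lemma displacement_lower N n A (j i : int) t : is_symbol v A ->
  j <= i -> N <= j -> j < N + n%:Z -> t \in movable v j i A ->
  (displacement N n (lower v i (movable v j i A) A) < displacement N n A)%N.
Proof.
move=> symA leji leNj ltj; rewrite !inE => /andP[jt /eqP eqt].
have le s k : (`|(lower v i (movable v j i A) A s k - k)%R| <= `|(A s k - k)%R|)%N.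
  have [->|nek] := eqVneq k j; last by rewrite lower_movable_off.
  have [js|js] := boolP (j <= v s); last by rewrite lower_out // !inE (negPf js).
  by rewrite lower_movable_on //; case: eqP; lia.
have ltm : (`|(j - N)%R| < n)%N by lia.
apply: (@ltn_sum _ _ _ t) => [s|]; first by apply: leq_sum => m _; apply: le.
apply: (@ltn_sum _ _ _ (Ordinal ltm)) => [m|] /=; first exact: le.
have -> : N + `|(j - N)%R|%N%:Z = j by lia.
by rewrite lower_movable_on // eqt eqxx; lia.
Qed.

Lemma ordered_expansion A : ordered_array A -> exists w : seq (int * nat),
  [/\ sorted (fun x y => x.1 != y.1) w, is_expansion (Fdiv_word v w) A
    & head_raises w A].
Proof.
move=> ordA; have [N NP] := symbol_trivial (ordered_symbol ordA).
(* The window runs from N to M when N <= M: columns up to N are trivial and those beyond M are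
   empty. *)
have [M MP] := column_empty v; pose n := `|M - N|%N.+1.
have [d] := ubnP (displacement N n A); elim: d A ordA NP => // d IHd A ordA NP ltd.
have symA := ordered_symbol ordA.
pose P m := [exists t, (N + m%:Z <= v t) && (A t (N + m%:Z) != N + m%:Z)].
have notP k : (N < k -> ~~ P (`|(k - N)%R|)%N) -> forall t, k <= v t -> A t k = k.
  move=> nP t kt; have [|ltNk] := leP k N; first exact: NP.
  have /existsPn/(_ t) := nP ltNk; have -> : N + (`|(k - N)%R|)%N%:Z = k by lia.
  by rewrite kt /= negbK => /eqP.
have [exP|/forallNP noP] := pselect (exists m, P m); last first.
  exists [::]; split=> //; apply: empty_expansion => t k kt.
  by apply: notP => // _; apply/negP/noP.
(* The least m selects the leftmost nontrivial column j. *)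
have [m /existsP[t0 /andP[]]] := ex_minnP exP.
set j := N + m%:Z => jt0 net0 min_m.
have ltNj : N < j by rewrite ltNge; apply: contra net0 => /NP ->.
have triv s k : k < j -> k <= v s -> A s k = k.
  by move=> ltk; apply: notP => ltNk; apply/negP => /min_m; lia.
have jcol : t0 \in column v j by rewrite inE.
(* The column is sorted, so its last row holds its maximum, taken to be i + 1. *)
have [tm jtm max_tm] := @arg_maxnP _ t0 (mem (column v j)) (fun t : 'I_l => t : nat) jcol.
have {}jtm : tm \in column v j by [].
have max s : j <= v s -> A s j <= A tm j.
  by move=> js; apply: (ordered_sorted ordA) => //; apply: max_tm; rewrite /= inE.
pose i := A tm j - 1; have eqi : A tm j = i + 1 by rewrite subrK.
have leji : j <= i.
  have ltj : j - 1 < j by lia.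
  have jt : j - 1 <= v t0 by lia.
  have [mono _ _] := symA t0; have := mono _ _ ltj jt0; rewrite (triv _ _ ltj jt).
  by have := max _ jt0; move: net0; lia.
have tm_mov : tm \in movable v j i A by rewrite inE jtm eqi eqxx.
have proA : lower_profile v j i A.
  split=> [t k|t jt|t k ltk kt]; first exact: triv.
    by rewrite -eqi max.
  by rewrite -eqi; apply: (ordered_columns ordA) => //; rewrite inE in jtm.
have leM : j <= M by rewrite leNgt; apply/negP => /MP e; rewrite e inE in jcol.
have ordT := lower_ordered ordA leji proA.
have [||w [sorted_w expw headw]] := IHd _ ordT.
- move=> t k kN; rewrite lower_movable_off ?NP // lt_eqF //.
  exact: le_lt_trans kN ltNj.
- rewrite -ltnS; apply: leq_trans ltd.
  by rewrite ltnS; apply: (displacement_lower _ _ _ _ tm_mov); rewrite // /n; lia.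
have [sorted_w' headw'] := head_raises_cons ordA leji proA #|movable v j i A|
  (ex_intro _ tm tm_mov) sorted_w headw.
exists ((i, #|movable v j i A|) :: w); split=> //.
exact: (Fdiv_step hv leji symA proA expw).
Qed.

End OrderedArrays.

(** * Admissible permutations *)

Section Admissible.

Variables (l : nat) (v : 'I_l -> int).
Hypothesis hv : multicharge v.
Implicit Types (A : array l) (sigma w : int -> 'S_l).

Definition stable_family A sigma : Prop :=
  forall j, stable_sort_of (column v j) (fun t => A t j) (sigma j).

Lemma exists_stable_family A : exists sigma, stable_family A sigma.
Proof.
have /choice[sigma sigmaP] : forall j, exists s, stable_sort_of (column v j) (fun t => A t j) s.
  move=> j; have [s [sP _]] := exists_stable_sort (fun t => A t j) (@column_down_closed _ v j hv).
  by exists s.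
by exists sigma.
Qed.

Lemma stable_family_length A sigma : is_symbol v A -> stable_family A sigma ->
  perm_length v sigma = Some (inversion_stat v A).
Proof.
move=> symA sigmaP; rewrite /perm_length asboolT; last first.
  apply: sub_finite_set (finite_inversions symA) => j /= ne1.
  apply/negP; rewrite cards_eq0 => /eqP inv0; apply: ne1; apply: inversions_inj.
  by rewrite inversions1 -inv0; have [_ ->] := sigmaP j.
congr Some; apply: eq_fsbigr => j _; have [sD inv_s] := sigmaP j.
by rewrite col_lengthE // inv_s.
Qed.

Variable S : array l.
Hypothesis ordS : ordered_array v S.

Let sortS : sorted_columns v S := ordered_sorted ordS.

Lemma permute_same_columns sigma : Defs.col_perm v sigma -> same_columns v (permute S sigma) S.
Proof.
move=> sD j x; rewrite -(card_imset _ (@perm_inj _ (sigma j))); apply: eq_card => t.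
apply/imsetP/idP => [[s]|].
  by rewrite !inE /permute => /andP[js eqs] ->; have := perm_closed s (sD j); rewrite !inE js => ->.
rewrite !inE => /andP[jt eqt]; exists ((sigma j)^-1 t)%g; last by rewrite permKV.
rewrite !inE /permute permKV eqt andbT.
by have := perm_closed ((sigma j)^-1 t)%g (sD j); rewrite permKV !inE jt => <-.
Qed.

Lemma permute_inversions_sub sigma j : Defs.col_perm v sigma ->
  column_inversions v (permute S sigma) j \subset inversions (sigma j).
Proof.
move=> sD; apply: (@stable_sort_card_le _ _ (fun t => permute S sigma t j)
  (@column_down_closed _ v j hv) (fun t => S t j)) => //.
exact: sortS.
Qed.

(** The bound holds column by column, so equality of the totals forces it in each column, where
    inclusion of inversion sets becomes equality. *)
Lemma perm_length_spec sigma n : is_symbol v (permute S sigma) -> Defs.col_perm v sigma ->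
  perm_length v sigma = Some n ->
  (inversion_stat v (permute S sigma) <= n)%N /\
  ((n <= inversion_stat v (permute S sigma))%N -> stable_family (permute S sigma) sigma).
Proof.
move=> symU sD; rewrite /perm_length; case: asboolP => // fin [<-].
have finl : finite_set [set j | col_length v j (sigma j) != 0%N]%classic.
  apply: sub_finite_set fin => j /= ne0 eq1; move: ne0.
  by rewrite col_lengthE // eq1 inversions1 cards0.
have le j : (#|column_inversions v (permute S sigma) j| <= col_length v j (sigma j))%N.
  by rewrite col_lengthE //; apply/subset_leq_card/permute_inversions_sub.
have fini := finite_inversions symU.
split=> [|ge j]; first exact: fsum_le.
split=> //; apply/esym/eqP; rewrite eqEcard permute_inversions_sub //=.
by have := fsum_eq fini finl le ge j; rewrite col_lengthE // => ->.
Qed.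

Lemma permute_stable_family A w : is_symbol v A -> same_columns v A S ->
  stable_family A w -> permute S w = A.
Proof.
move=> symA same wP; apply/funext => t; apply/funext => j; rewrite /permute.
have [tj|tj] := boolP (t \in column v j).
  by rewrite -(stable_sortE (@column_down_closed _ v j hv) (@sortS j) (same j) (wP j) tj).
have [wD _] := wP j; rewrite (out_perm wD tj).
have [_ _ outA] := symA t; have [_ _ outS] := ordered_symbol ordS t.
by rewrite inE -ltNge in tj; rewrite outA ?outS.
Qed.

End Admissible.

(** * From column permutations to symbols *)

Section Expansion.

Variables (l : nat) (v : 'I_l -> int) (S : symbol v).
Hypotheses (hv : multicharge v) (ordS : ordered_array v (val S)).

(** The stable family of an array produces that same array from [S] and attains the lower bound on
    length; minimality thus puts [sigma] in the equality case of [perm_length_spec]. *)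
Lemma admissibleP sigma : admissible S sigma <->
  is_symbol v (permute (val S) sigma) /\ stable_family v (permute (val S) sigma) sigma.
Proof.
split=> [[sD symU min]|[symU stable]].
  split=> //; have [w wP] := exists_stable_family hv (permute (val S) sigma).
  have eqU := permute_stable_family hv ordS symU (permute_same_columns _ sD) wP.
  have wD : Defs.col_perm v w by move=> j; have [] := wP j.
  have := min w wD eqU; rewrite (stable_family_length hv symU wP).
  case eqn: (perm_length v sigma) => [n|//] /= le.
  by have [_] := perm_length_spec hv ordS symU sD eqn; apply.
have sD : Defs.col_perm v sigma by move=> j; have [] := stable j.
split=> // w wD eqU; rewrite (stable_family_length hv symU stable) -eqU.
rewrite -eqU in symU; case eqn: (perm_length v w) => [n|//] /=.
by have [] := perm_length_spec hv ordS symU wD eqn.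
Qed.

(** The map sending [sigma] to [S^sigma] is a bijection from the admissible permutations to the
    support of [g]; its inverse [h] picks the stable family of a symbol. *)
Lemma expansion_eq (g : fock v) : is_expansion g (val S) ->
  \sum_(sigma \in [set sigma | admissible S sigma]%classic)
    q ^ Nstat sigma S *: basis_vec v (permute (val S) sigma) = g.
Proof.
move=> gS; have /choice[h hP] : forall U : symbol v, exists sigma, stable_family v (val U) sigma.
  by move=> U; apply: exists_stable_family.
have hU U : same_columns v (val U) (val S) -> permute (val S) (h U) = val U.
  by move=> same; apply: (permute_stable_family hv ordS (symbolP U) same (hP U)).
have msuppE U : (U \in msupp g) = `[< same_columns v (val U) (val S) >].
  by rewrite -mcoeff_neq0 gS; case: asboolP => _; rewrite ?eqxx // expfz_neq0 ?q_neq0.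
rewrite (reindex_fsbig h [set` msupp g]%classic); last first.
  split=> [U /= | U U' | sigma /= /admissibleP[symU stable]].
  - rewrite msuppE => /asboolP same; apply/admissibleP; rewrite hU //.
    by split; [exact: symbolP | exact: hP].
  - move=> /set_mem /= + /set_mem /=; rewrite !msuppE => /asboolP same /asboolP same' eqh; apply: val_inj.
    by rewrite -hU // eqh hU.
  exists (Symbol symU); last first.
    by apply/funext => j; apply: stable_sort_unique (stable j); apply: hP.
  rewrite /= msuppE; apply/asboolP/permute_same_columns => j.
  by have [] := stable j.
rewrite -fsbig_seq ?fset_uniq // [RHS]monalgE; apply: eq_big_seq => U.
rewrite msuppE => /asboolP same; apply/malgP => W.
rewrite gS asboolT // mcoeffZ hU // coef_basis_vec mcoeffU val_eqE /Nstat hU //.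
rewrite (stable_family_length hv (symbolP U) (hP U)) /= -/(exponent v (val U)).
by case: eqP => _; rewrite ?mulr1 // mulr0.
Qed.

End Expansion.

(** * Canonical basis *)

Section Canonical.

Variables (l : nat) (v : 'I_l -> int).
Implicit Types (u x : fock v) (c : Qq) (i : int).

Lemma coef_linear c x u (A : array l) : coef (c *: x + u) A = c * coef x A + coef u A.
Proof.
rewrite /coef; case: insubP => [T _ _|_]; last by rewrite mulr0 addr0.
by rewrite mcoeffD mcoeffZ.
Qed.

Lemma malgU_scale c (T : symbol v) : << c *g T >> = c *: << T >> :> fock v.
Proof. by apply/malgP => W; rewrite [LHS]mcoeffU [RHS]mcoeffZ [X in c * X]mcoeffU mulr_natr. Qed.

Lemma F_linear i c x u : F i (c *: x + u) = c *: F i x + F i u.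
Proof.
apply/malgP => W; rewrite [LHS]F_coef mcoeffD mcoeffZ [X in c * X]F_coef [X in _ = _ + X]F_coef.
rewrite mulr_sumr -big_split /=.
by apply: eq_bigr => t _; rewrite coef_linear mulrDr mulrCA.
Qed.

Lemma F0 i : F i 0 = 0 :> fock v.
Proof. by rewrite /F msupp0 big_seq_fset0. Qed.

Lemma span_scale (X : fock v -> Prop) c u :
  Defs.span (fun=> True) X u -> Defs.span (fun=> True) X (c *: u).
Proof.
elim=> [|d x w _ Xx _ IH]; first by rewrite scaler0; apply: Defs.span_nil.
by rewrite scalerDr scalerA; apply: Defs.span_cons.
Qed.

Lemma V_F i u : V u -> V (F i u).
Proof.
elim=> [|c x w _ [s ->] _ IH]; first by rewrite F0; apply: Defs.span_nil.
by rewrite F_linear; apply: Defs.span_cons => //; exists (i :: s).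
Qed.

Lemma V_iterF i a u : V u -> V (iter a (F i) u).
Proof. by move=> Vu; elim: a => [|a IHa] //=; apply: V_F. Qed.

Lemma V_Fdiv_word (w : seq (int * nat)) : V (Fdiv_word v w).
Proof.
elim: w => [|[i a] w IHw] /=; last by apply: span_scale; apply: V_iterF.
rewrite -[vacuum v]addr0 -[vacuum v]scale1r; apply: Defs.span_cons => //.
  by exists [::].
exact: Defs.span_nil.
Qed.

Lemma VZ_Fdiv_word (w : seq (int * nat)) : VZ (Fdiv_word v w).
Proof.
rewrite -[Fdiv_word v w]addr0 -[Fdiv_word v w]scale1r; apply: Defs.span_cons.
- by exists 1, 0%N; rewrite rmorph1 hornerC expr0 divr1.
- by exists w.
- exact: Defs.span_nil.
Qed.

(** Each F_i commutes with [bar] and quantum factorials are invariant; membership in [V] is carried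
    along because [bar] is specified only there. *)
Lemma bar_Fdiv_word bar (w : seq (int * nat)) : is_bar_involution bar ->
  bar (Fdiv_word v w) = Fdiv_word v w.
Proof.
move=> hbar; elim: w => [|[i a] w IHw] /=; first exact: bar_vacuum hbar.
have Vw := V_Fdiv_word w.
rewrite /Fdiv (bar_scale hbar); last exact: V_iterF.
rewrite (bar_invariantP (bar_invariantV (bar_invariant_qfact a))); congr (_ *: _).
elim: a => [//|a IHa] /=; rewrite (bar_F hbar) ?IHa //; exact: V_iterF.
Qed.

Lemma fock_regular0_coef u : (forall W, regular0 u@_W) -> fock_regular0 u.
Proof.
move=> reg; rewrite [u]monalgE; elim: (enum_fset _) => [|T r IHr].
  by rewrite big_nil; apply: Defs.span_nil.
rewrite big_cons malgU_scale.
by apply: Defs.span_cons => //; exists T.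
Qed.

Lemma regular0_Xn (n : nat) : regular0 (q ^+ n).
Proof.
by exists 'X^n, 1; rewrite tofrac1 divr1 hornerC oner_neq0 tofracXn.
Qed.

Lemma regular0_0 : regular0 0.
Proof. by exists 0, 1; rewrite tofrac0 mul0r hornerC oner_neq0. Qed.

Lemma expansion_leading (S : symbol v) (g : fock v) : multicharge v ->
  ordered_array v (val S) -> is_expansion g (val S) ->
  exists2 u, fock_regular0 u & g - << S >> = q *: u.
Proof.
move=> hv ordS gS; exists (q^-1 *: (g - << S >>)); last first.
  by rewrite scalerA mulfV ?q_neq0 // scale1r.
apply: fock_regular0_coef => W; rewrite mcoeffZ mcoeffB gS mcoeffU.
have [<-|neW] := eqVneq S W.
  rewrite asboolT // exponent_sorted ?subrr ?mulr0 //; last exact: ordered_sorted.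
    exact: regular0_0.
  exact: symbolP.
rewrite subr0; case: asboolP => [same|_]; last by rewrite mulr0; apply: regular0_0.
have symW := symbolP W; have := exponent_ge0 hv symW.
(* A positive exponent absorbs the factor q^-1; exponent 0 would leave no inversions and force W =
   S. *)
case eqn: (exponent v (val W)) => [[|n]|] // _; last first.
  rewrite -exprnP exprS mulKf ?q_neq0 //; apply: regular0_Xn.
case/eqP: neW; apply/esym/val_inj; apply: (same_columns_sorted hv symW (symbolP S) _ same).
  exact: ordered_sorted.
by move=> j; apply: exponent_eq0.
Qed.

End Canonical.

Theorem theorem4p3 (l : nat) (v : 'I_l -> int) (hl : (1 <= l)%N)
    (hv : multicharge v) (bar : fock v -> fock v) (hbar : is_bar_involution bar)
    (S : symbol v) (hS : ordered S) :
  let GS : fock v :=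
    \sum_(sigma \in [set sigma | admissible S sigma]%classic)
      q ^ Nstat sigma S *: basis_vec v (permute (val S) sigma) in
  [/\ canonical_spec bar S GS,
      forall g, is_canonical_element bar S g -> g = GS
    & monomial GS].
Proof.
move=> GS; have ordS := ordered_arrayP hv hS.
have [w [sorted_w wS _]] := ordered_expansion hv ordS.
(* All three claims are read off this equality with a word of divided powers applied to the
   vacuum. *)
have GSE : GS = Fdiv_word v w by apply: expansion_eq.
have specGS : canonical_spec bar S GS.
  rewrite GSE; split; [exact: VZ_Fdiv_word | exact: bar_Fdiv_word | exact: expansion_leading].
split=> //; last by exists w.
by move=> g [_ uniq_g]; apply: uniq_g.
Qed.
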